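(* Let $M$ be an $m$-dimensional compact cohomogeneity one manifold with orbit space $[0,L]$, let $r:[0,L]\to\mathbb{R}$ be a solution of $\tau_{|\gamma(t)}=0$ (that is, $\tau^{\mathrm{nor}}_{|\gamma(t)}=0$ and $\tau^{\mathrm{tan}}_{|\gamma(t)}=0$), and let $\phi$ be the associated harmonic self-map $a\cdot\gamma(t)\mapsto a\cdot\gamma(r(t))$ of $M$. Then the corresponding Jacobi equation, i.e. the equation $\frac{d}{ds}\big|_{s=0}\tau[r_s]_{|\gamma(t)}+\lambda\xi(t)=0$ for variations $r_s$ of $r$ with $r_0=r$ and $\frac{d}{ds}|_{s=0}r_s=\xi$, is given by $$\ddot\xi(t)+\tfrac12\operatorname{Tr}(P_t^{-1}\dot P_t)\,\dot\xi(t)-\tfrac12\operatorname{Tr}(P_t^{-1}\ddot P_{r(t)})\,\xi(t)+\sum_{j=1}^{m-1}\frac{d}{d\rho}\Big|_{\rho=r(t)}\big(P_\rho^{-1}B_+^{\rho}(e_j,e_j)\big)\,\xi(t)+\lambda\,\xi(t)=0,$$ where $\xi\in C_0^\infty([0,L])$.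
   Context: Setting: $M$ is a compact Riemannian manifold with an isometric action of a compact Lie group $G$ such that $M/G$ is isometric to $[0,L]$ and the Weyl group of the action is finite. $\gamma$ is a fixed unit speed normal geodesic with $\gamma(0)$ in a non-principal orbit. A $(k,r)$-map is a map $a\cdot\gamma(t)\mapsto a\cdot\gamma(r(t))$, $a\in G$, with $r:[0,L]\to\mathbb{R}$ smooth, $r(0)=0$, $r(L)=kL$. Let $Q$ be a fixed biinvariant metric on $G$, $\mathfrak g$ the Lie algebra of $G$, $\mathfrak h$ the Lie algebra of the principal isotropy group $H$ along $\gamma$, and $\mathfrak n$ the $Q$-orthogonal complement of $\mathfrak h$ in $\mathfrak g$. The metric endomorphism $P_t:\mathfrak n\to\mathfrak n$ is defined by $Q(X,P_tY)=\langle X^*,Y^*\rangle_{|\gamma(t)}$, where $Z^*$ is the action field of $Z\in\mathfrak n$. $\dot P$, $\ddot P$ denote derivatives of $\tau\mapsto P_\tau$, and $\dot P_{r(t)}$, $\ddot P_{r(t)}$ are these derivatives evaluated at the parameter $r(t)$. For $\rho\in\mathbb{R}$ set $B_+^{\rho}(X,Y)=\frac12([X,P_\rho Y]-[P_\rho X,Y])$ for $X,Y\in\mathfrak n$. For each $t\in(0,L)$, $e_1,\dots,e_{m-1}\in\mathfrak n$ (depending on $t$, not on the variation parameter) are such that $e_1^*,\dots,e_{m-1}^*$ form an orthonormal basis of the tangent space of the orbit at $\gamma(t)$. The tension field of a $(k,r)$-map is $\tau[r]_{|\gamma(t)}=\tau^{\mathrm{nor}}_{|\gamma(t)}+\tau^{\mathrm{tan}}_{|\gamma(t)}$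 with $$\tau^{\mathrm{nor}}_{|\gamma(t)}=\ddot r(t)+\tfrac12\dot r(t)\operatorname{Tr}P_t^{-1}\dot P_t-\tfrac12\operatorname{Tr}P_t^{-1}\dot P_{r(t)},\qquad \tau^{\mathrm{tan}}_{|\gamma(t)}=\sum_{j=1}^{m-1}P_{r(t)}^{-1}B_+^{r(t)}(e_j,e_j).$$ Here scalars are identified with multiples of the normal direction $\dot\gamma(r(t))$ and elements of $\mathfrak n$ with tangent vectors of the orbit through $\gamma(r(t))$, so sums of scalars and elements of $\mathfrak n$ are taken in the direct sum $\mathbb{R}\oplus\mathfrak n$. The formulas are understood at those $t\in(0,L)$ where $P_{r(t)}$ is invertible. $C_0^\infty([0,L])$ denotes smooth functions on $[0,L]$ vanishing at $0$ and $L$. *)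

(* Defs.v *)
(* MathComp / MathComp-Analysis *)
From HB Require Import structures.
From mathcomp Require Import all_boot all_order all_algebra.
From mathcomp Require Import all_classical all_reals all_analysis.

Set Implicit Arguments.
Unset Strict Implicit.
Unset Printing Implicit Defensive.

Import Order.TTheory GRing.Theory Num.Theory numFieldNormedType.Exports.

Local Open Scope classical_set_scope.
Local Open Scope ring_scope.

Section SmoothFunctions.
Context {R : realType}.

Fixpoint Ck_on (n k : nat) (E : set 'rV[R]_n) (f : 'rV[R]_n -> R) : Prop :=
  if k is k'.+1 then
    (forall x, E x -> differentiable f x) /\
    (forall i : 'I_n, Ck_on k' E (fun x => 'D_(delta_mx 0 i) f x))
  else forall x, E x -> {for x, continuous f}.

(* to be used for open E *)
Definition smooth_on (n : nat) (E : set 'rV[R]_n) (f : 'rV[R]_n -> R) : Prop :=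
  forall k, Ck_on k E f.

Definition smooth_line (f : R -> R) : Prop :=
  forall (n : nat) (t : R), derivable (derive1n n f) t 1.

(* Smoothness up to the boundary, as restriction of a smooth function on R;
   the values of f outside [0, L] are irrelevant. *)
Definition smooth_segment (L : R) (f : R -> R) : Prop :=
  exists2 F, smooth_line F & forall t, 0 <= t <= L -> f t = F t.

Definition C0oo (L : R) (f : R -> R) : Prop :=
  [/\ smooth_segment L f, f 0 = 0 & f L = 0].

(* The family s |-> r_ s, s in (-eps, eps), is smooth in (s, t) on
   (-eps, eps) x [0, L]. *)
Definition smooth_family (L eps : R) (r_ : R -> R -> R) : Prop :=
  exists2 F : R -> R -> R,
    smooth_on [set z : 'rV[R]_2 | - eps < z 0 0 < eps]
              (fun z => F (z 0 0) (z 0 1)) &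
    forall s t, - eps < s < eps -> 0 <= t <= L -> r_ s t = F s t.

Record profile_variation (L : R) (r : R -> R) (xi : R -> R) (eps : R)
    (r_ : R -> R -> R) : Prop := {
  variation_eps : 0 < eps ;
  variation_smooth : smooth_family L eps r_ ;
  variation0 : forall t, 0 <= t <= L -> r_ 0 t = r t ;
  variation_deriv : forall t, 0 <= t <= L -> derive1 (r_ ^~ t) 0 = xi t }.

End SmoothFunctions.

Section Manifolds.
Context {R : realType}.

(* c_inv is only meaningful on the image of the domain. *)
Record chart (M : topologicalType) (m : nat) := Chart {
  c_dom : set M ;
  c_map : M -> 'rV[R]_m ;
  c_inv : 'rV[R]_m -> M }.

Definition c_img (M : topologicalType) m (c : chart M m) : set 'rV[R]_m :=
  c_map c @` c_dom c.

Record smooth_atlas (M : topologicalType) m (A : set (chart M m)) : Prop := {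
  atlas_cover : forall p, exists2 c, A c & c_dom c p ;
  atlas_dom : forall c, A c -> open (c_dom c) ;
  atlas_img : forall c, A c -> open (c_img c) ;
  atlas_inv : forall c, A c -> forall p, c_dom c p -> c_inv c (c_map c p) = p ;
  atlas_map_cont : forall c, A c ->
    forall p, c_dom c p -> {for p, continuous (c_map c)} ;
  atlas_inv_cont : forall c, A c ->
    forall x, c_img c x -> {for x, continuous (c_inv c)} ;
  atlas_trans : forall c d, A c -> A d -> forall i : 'I_m,
    smooth_on (c_map c @` (c_dom c `&` c_dom d))
              (fun x => c_map d (c_inv c x) 0 i) }.

(* A compact Hausdorff locally Euclidean space is second countable. *)
Record compact_manifold (M : topologicalType) m (A : set (chart M m)) : Prop := {
  cm_hausdorff : hausdorff_space M ;
  cm_compact : compact [set: M] ;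
  cm_atlas : smooth_atlas A }.

Definition smooth_map (M N : topologicalType) m n
    (A : set (chart M m)) (B : set (chart N n)) (F : M -> N) : Prop :=
  continuous F /\
  forall c d, A c -> B d -> forall i : 'I_n,
    smooth_on (c_img c `&` [set x | c_dom d (F (c_inv c x))])
              (fun x => c_map d (F (c_inv c x)) 0 i).

Definition line_atlas : set (chart R 1) :=
  [set Chart setT (fun t => const_mx t) (fun x => x 0 0)].

Definition prod_chart (M N : topologicalType) m n
    (c : chart M m) (d : chart N n) : chart (M * N)%type (m + n) :=
  Chart (c_dom c `*` c_dom d)
        (fun p => row_mx (c_map c p.1) (c_map d p.2))
        (fun x => (c_inv c (lsubmx x), c_inv d (rsubmx x))).

Definition prod_atlas (M N : topologicalType) m n
    (A : set (chart M m)) (B : set (chart N n)) :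
    set (chart (M * N)%type (m + n)) :=
  [set e | exists c d, [/\ A c, B d & e = prod_chart c d]].

Definition smooth_fun (M : topologicalType) m (A : set (chart M m)) :
    (M -> R) -> Prop := smooth_map A line_atlas.

Definition smooth_curve (M : topologicalType) m (A : set (chart M m)) :
    (R -> M) -> Prop := smooth_map line_atlas A.

(* Tangent vectors are directional derivative operators. They are applied to
   smooth functions only: two of them which agree on smooth functions
   represent the same tangent vector. *)
Definition tvec (M : Type) := (M -> R) -> R.

Definition tangent_eq (M : topologicalType) m (A : set (chart M m))
    (v w : tvec M) : Prop := forall f, smooth_fun A f -> v f = w f.

Definition chart_vector (M : topologicalType) m (c : chart M m)
    (u : 'rV[R]_m) (p : M) : tvec M :=
  fun f => 'D_u (f \o c_inv c) (c_map c p).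

Definition tangent_at (M : topologicalType) m (A : set (chart M m))
    (p : M) (v : tvec M) : Prop :=
  exists c u, [/\ A c, c_dom c p & tangent_eq A v (chart_vector c u p)].

Definition vector_field (M : topologicalType) m (A : set (chart M m))
    (V : M -> tvec M) : Prop :=
  (forall p, tangent_at A p (V p)) /\
  (forall f, smooth_fun A f -> smooth_fun A (fun p => V p f)).

Definition push (M N : Type) (F : M -> N) (v : tvec M) : tvec N :=
  fun f => v (f \o F).

Definition velocity (M : Type) (c : R -> M) (t : R) : tvec M :=
  fun f => derive1 (f \o c) t.

Record riemannian (M : topologicalType) m (A : set (chart M m))
    (met : M -> tvec M -> tvec M -> R) : Prop := {
  met_ext : forall p u v w, tangent_at A p u -> tangent_at A p v ->
    tangent_at A p w -> tangent_eq A u v -> met p u w = met p v w ;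
  met_sym : forall p u v, tangent_at A p u -> tangent_at A p v ->
    met p u v = met p v u ;
  met_lin : forall p (a : R) u v w, tangent_at A p u -> tangent_at A p v ->
    tangent_at A p w ->
    met p (fun f => a * u f + v f) w = a * met p u w + met p v w ;
  met_pos : forall p v, tangent_at A p v -> ~ tangent_eq A v (fun=> 0) ->
    0 < met p v v ;
  met_smooth : forall V W, vector_field A V -> vector_field A W ->
    smooth_fun A (fun p => met p (V p) (W p)) }.

Definition isometric (M : topologicalType) m (A : set (chart M m))
    (met : M -> tvec M -> tvec M -> R) (F : M -> M) : Prop :=
  forall p v w, tangent_at A p v -> tangent_at A p w ->
    met (F p) (push F v) (push F w) = met p v w.

Definition metric_mx (M : topologicalType) m
    (met : M -> tvec M -> tvec M -> R) (c : chart M m) (x : 'rV[R]_m) : 'M[R]_m :=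
  let p := c_inv c x in
  \matrix_(i, j) met p (chart_vector c (delta_mx 0 i) p)
                       (chart_vector c (delta_mx 0 j) p).

Definition christoffel (M : topologicalType) m
    (met : M -> tvec M -> tvec M -> R) (c : chart M m) (x : 'rV[R]_m)
    (k i j : 'I_m) : R :=
  let g := metric_mx met c in
  let D (l : 'I_m) (f : 'rV[R]_m -> R) := 'D_(delta_mx 0 l) f x in
  2^-1 * \sum_(l < m) invmx (g x) k l *
    (D i (fun y => g y j l) + D j (fun y => g y i l) - D l (fun y => g y i j)).

Definition geodesic (M : topologicalType) m (A : set (chart M m))
    (met : M -> tvec M -> tvec M -> R) (gamma : R -> M) : Prop :=
  smooth_curve A gamma /\
  forall c t, A c -> c_dom c (gamma t) -> forall k : 'I_m,
    let x (i : 'I_m) (s : R) : R := c_map c (gamma s) 0 i in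
    derive1n 2 (x k) t +
      \sum_(i < m) \sum_(j < m) christoffel met c (c_map c (gamma t)) k i j *
        derive1 (x i) t * derive1 (x j) t = 0.

Definition curve_length (M : topologicalType)
    (met : M -> tvec M -> tvec M -> R) (c : R -> M) : \bar R :=
  (\int[lebesgue_measure]_(t in `[0%R, 1%R])
    (Num.sqrt (met (c t) (velocity c t) (velocity c t)))%:E)%E.

End Manifolds.

Arguments chart R M m : clear implicits.
Arguments tvec R M : clear implicits.

(* Only the carrier: compatibility of the two structures is lie_group below. *)
#[short(type="groupTopologicalType")]
HB.structure Definition GroupTopological := {G of Group G & Topological G}.

Section LieGroups.
Context {R : realType}.

Record lie_group (G : groupTopologicalType) d (A : set (chart R G d)) : Prop := {
  lie_mul : smooth_map (prod_atlas A A) A (fun z : G * G => (z.1 * z.2)%g) ;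
  lie_inv : smooth_map A A (fun a : G => (a^-1)%g) }.

Definition left_invariant (G : groupTopologicalType) d (A : set (chart R G d))
    (V : G -> tvec R G) : Prop :=
  forall a b, tangent_eq A (V (a * b)%g) (push (fun x => (a * x)%g) (V b)).

(* fld identifies the vector space g with the left-invariant vector fields on G
   and br with their commutator. *)
Record lie_algebra (G : groupTopologicalType) d (A : set (chart R G d))
    (g : vectType R) (br : g -> g -> g) (fld : g -> G -> tvec R G) : Prop := {
  la_field : forall X, vector_field A (fld X) /\ left_invariant A (fld X) ;
  la_lin : forall (c : R) X Y a,
    tangent_eq A (fld (c *: X + Y) a) (fun f => c * fld X a f + fld Y a f) ;
  la_inj : forall X, (forall a, tangent_eq A (fld X a) (fun=> 0)) -> X = 0 ;
  la_surj : forall V, vector_field A V -> left_invariant A V ->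
    exists X, forall a, tangent_eq A (V a) (fld X a) ;
  la_bracket : forall X Y a,
    tangent_eq A (fld (br X Y) a)
      (fun f => fld X a (fun b => fld Y b f) - fld Y a (fun b => fld X b f)) }.

Definition biinvariant (G : groupTopologicalType) d (A : set (chart R G d))
    (metG : G -> tvec R G -> tvec R G -> R) : Prop :=
  forall a, isometric A metG (fun x => (a * x)%g) /\
            isometric A metG (fun x => (x * a)%g).

Definition one_parameter (G : groupTopologicalType) d (A : set (chart R G d))
    (c : R -> G) : Prop :=
  smooth_curve A c /\ forall s t, c (s + t) = (c s * c t)%g.

(* h is the Lie algebra of the closed subgroup H *)
Definition lie_subalgebra_of (G : groupTopologicalType) d
    (A : set (chart R G d)) (g : vectType R) (fld : g -> G -> tvec R G)
    (H : set G) (h : {vspace g}) : Prop :=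
  forall X, X \in h <->
    exists c, [/\ one_parameter A c,
                  tangent_eq A (velocity c 0) (fld X 1%g) & forall s, H (c s)].

Section Actions.
Variables (G : groupTopologicalType) (M : topologicalType) (act : G -> M -> M).

Record smooth_action d (AG : set (chart R G d)) m (AM : set (chart R M m)) :
    Prop := {
  action1 : forall p, act 1%g p = p ;
  actionM : forall a b p, act (a * b)%g p = act a (act b p) ;
  action_smooth :
    smooth_map (prod_atlas AG AM) AM (fun z : G * M => act z.1 z.2) }.

Definition group_orbit (p : M) : set M := range (act ^~ p).

Definition isotropy (p : M) : set G := [set a | act a p = p].

(* minimal isotropy type: up to conjugation, the isotropy group at p is
   contained in every other isotropy group *)
Definition principal (p : M) : Prop :=
  forall q, exists a, [set (a * b * a^-1)%g | b in isotropy p] `<=` isotropy q.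

(* the value X^*_p of the action field: differential at 1 of a |-> a . p *)
Definition action_field (g : vectType R) (fld : g -> G -> tvec R G)
    (X : g) (p : M) : tvec R M := push (act ^~ p) (fld X 1%g).

(* distance of the orbits of p and q in the quotient metric of M / G *)
Definition orbit_distance m (A : set (chart R M m))
    (met : M -> tvec R M -> tvec R M -> R) (p q : M) : \bar R :=
  ereal_inf [set curve_length met c | c in
    [set c | [/\ smooth_curve A c, group_orbit p (c 0) & group_orbit q (c 1)]]].

(* pi induces an isometry of M / G onto [0, L] *)
Definition quotient_isometric_segment m (A : set (chart R M m))
    (met : M -> tvec R M -> tvec R M -> R) (L : R) : Prop :=
  exists pi : M -> R,
    range pi = `[0, L]%classic /\
    forall p q, orbit_distance A met p q = `|pi p - pi q|%:E.

Variable gamma : R -> M.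

Definition curve_fixator : set G := [set a | forall t, act a (gamma t) = gamma t].

Definition curve_stabilizer : set G := [set a | act a @` range gamma = range gamma].

(* the Weyl group is curve_stabilizer / curve_fixator, as a set of cosets *)
Definition finite_weyl_group : Prop :=
  finite_set [set [set (a * b)%g | b in curve_fixator] | a in curve_stabilizer].

Record normal_geodesic m (A : set (chart R M m))
    (met : M -> tvec R M -> tvec R M -> R) (g : vectType R)
    (fld : g -> G -> tvec R G) : Prop := {
  ng_geodesic : geodesic A met gamma ;
  ng_unit : forall t, met (gamma t) (velocity gamma t) (velocity gamma t) = 1 ;
  ng_normal : forall t X,
    met (gamma t) (velocity gamma t) (action_field fld X (gamma t)) = 0 ;
  ng_start : ~ principal (gamma 0) }.

Record kr_map (L k : R) (r : R -> R) (phi : M -> M) : Prop := {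
  kr_smooth : smooth_segment L r ;
  kr_0 : r 0 = 0 ;
  kr_L : r L = k * L ;
  kr_phi : forall a t, 0 <= t <= L -> phi (act a (gamma t)) = act a (gamma (r t)) }.

End Actions.

Record compact_cohomogeneity_one
    (M : topologicalType) m (AM : set (chart R M m))
    (metM : M -> tvec R M -> tvec R M -> R)
    (G : groupTopologicalType) d (AG : set (chart R G d))
    (act : G -> M -> M) (g : vectType R) (br : g -> g -> g)
    (fld : g -> G -> tvec R G) (L : R) (gamma : R -> M) : Prop := {
  co1_M : compact_manifold AM ;
  co1_metM : riemannian AM metM ;
  co1_G : compact_manifold AG ;
  co1_lie : lie_group AG ;
  co1_g : lie_algebra AG br fld ;
  co1_act : smooth_action act AG AM ;
  co1_isometric : forall a, isometric AM metM (act a) ;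
  co1_L : 0 < L ;
  co1_quotient : quotient_isometric_segment act AM metM L ;
  co1_gamma : normal_geodesic act gamma AM metM fld ;
  co1_weyl : finite_weyl_group act gamma }.

End LieGroups.

Section Derivatives.
Context {R : realType} (V : vectType R).

Let b := vbasis {:V}.

(* derivative of a curve in a finite-dimensional vector space, taken in the
   coordinates of a basis *)
Definition vderivable (f : R -> V) (t : R) : Prop :=
  forall i, derivable (fun s => coord b i (f s)) t 1.

Definition vderive (f : R -> V) (t : R) : V :=
  \sum_i derive1 (fun s => coord b i (f s)) t *: b`_i.

Definition lfun_trace (f : 'End(V)) : R := \sum_i coord b i (f b`_i).

End Derivatives.

Section Tension.
Context {R : realType} (g : vectType R) (br : g -> g -> g) (n : {vspace g}).
Variable P : R -> 'End(subvs_of n).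

(* For a metric endomorphism P the vector projected here already lies in n,
   so that vsproj only retypes it. *)
Definition Bplus (rho : R) (X Y : subvs_of n) : subvs_of n :=
  vsproj n (2^-1 *: (br (vsval X) (vsval (P rho Y))
                     - br (vsval (P rho X)) (vsval Y))).

Definition invertible_at (rho : R) : Prop := lker (P rho) == 0%VS.

Definition tension_nor (r : R -> R) (t : R) : R :=
  derive1n 2 r t
  + 2^-1 * derive1 r t * lfun_trace ((P t)^-1 \o vderive P t)%VF
  - 2^-1 * lfun_trace ((P t)^-1 \o vderive P (r t))%VF.

Variables (m : nat) (e : R -> 'I_m.-1 -> subvs_of n).

Definition tension_tan (r : R -> R) (t : R) : subvs_of n :=
  \sum_(j < m.-1) ((P (r t))^-1)%VF (Bplus (r t) (e t j) (e t j)).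

(* the direct sum of the normal line and n *)
Definition normal_sum : vectType R := (R^o * subvs_of n)%type.

Definition in_nor (x : R) : normal_sum := (x, 0).

Definition in_tan (X : subvs_of n) : normal_sum := (0, X).

Definition tension (r : R -> R) (t : R) : normal_sum :=
  in_nor (tension_nor r t) + in_tan (tension_tan r t).

Definition jacobi_operator (r xi : R -> R) (lambda t : R) : normal_sum :=
  in_nor (derive1n 2 xi t)
  + in_nor (2^-1 * lfun_trace ((P t)^-1 \o vderive P t)%VF * derive1 xi t)
  - in_nor (2^-1 * lfun_trace ((P t)^-1 \o vderive (vderive P) (r t))%VF * xi t)
  + in_tan (\sum_(j < m.-1)
      xi t *: vderive (fun rho => ((P rho)^-1)%VF (Bplus rho (e t j) (e t j))) (r t))
  + in_nor (lambda * xi t).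

End Tension.

Section OrbitFrames.
Context {R : realType} (M : topologicalType) (m : nat) (A : set (chart R M m)).
Variable met : M -> tvec R M -> tvec R M -> R.
Variables (G : groupTopologicalType) (act : G -> M -> M) (g : vectType R).
Variables (fld : g -> G -> tvec R G) (n : {vspace g}).

Definition metric_endomorphism (metG : G -> tvec R G -> tvec R G -> R)
    (gamma : R -> M) (P : R -> 'End(subvs_of n)) : Prop :=
  forall t (X Y : subvs_of n),
    metG 1%g (fld (vsval X) 1%g) (fld (vsval (P t Y)) 1%g) =
    met (gamma t) (action_field act fld (vsval X) (gamma t))
                  (action_field act fld (vsval Y) (gamma t)).

(* The vectors (e j)^* form an orthonormal basis of the tangent space of the
   orbit at p, which consists of the values at p of all action fields. *)
Definition orbit_frame (p : M) (e : 'I_m.-1 -> subvs_of n) : Prop :=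
  (forall i j, met p (action_field act fld (vsval (e i)) p)
                     (action_field act fld (vsval (e j)) p) = (i == j)%:R) /\
  (forall X : g, exists c : 'I_m.-1 -> R,
     tangent_eq A (action_field act fld X p)
       (fun f => \sum_j c j * action_field act fld (vsval (e j)) p f)).

Definition orthogonal_complement (metG : G -> tvec R G -> tvec R G -> R)
    (h : {vspace g}) : Prop :=
  forall Y, Y \in n <->
    forall X, X \in h -> metG 1%g (fld X 1%g) (fld Y 1%g) = 0.

End OrbitFrames.

(* Main.v *)
(* The profile enters the tension only through r(t), r'(t) and r''(t), so the
   derivative along a variation follows from the chain rule once three facts are
   known.  Mixed partial derivatives of the variation commute, so that s- and
   t-derivatives can be exchanged.  P is smooth in its parameter: action fields
   are smooth vector fields on M, hence the forms <X*, Y*> are smooth along gamma,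
   and P is recovered from them through the Gram matrix of Q, which is positive
   definite on n.  Finally the inverse of P is differentiable where P is
   invertible, by Cramer's rule. *)
Require Import Defs.
From HB Require Import structures.
From mathcomp Require Import all_boot all_order all_algebra.
From mathcomp Require Import all_classical all_reals all_analysis ring.

Set Implicit Arguments.
Unset Strict Implicit.
Unset Printing Implicit Defensive.

Import Order.TTheory GRing.Theory Num.Theory numFieldNormedType.Exports.
Local Open Scope classical_set_scope.
Local Open Scope ring_scope.

(** * Differential calculus on row vectors *)

Section Differentials.
Context {R : realType}.

(** The regularity needed is nowhere given directly: [P] is known only through the forms it
    represents, [br] only as a commutator of fields, and the variation agrees with a smooth function
    of two variables only for t in [0, L]. Everything is therefore brought down to coordinates.
    [Ck_on] differentiates total functions at the points of a set, so a function may be replaced by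
    another that agrees with it on the set only when the set is open. This is why openness is
    carried along, and why t stays in the open interval, where the t-derivatives of the variation
    are those of its smooth extension. An action field differentiates at the unit of G only. In a
    product chart of G and M it becomes a partial derivative of the jointly smooth function (a, p)
    |-> f (a p), hence is smooth in p; the product atlas is built for this. The factor [(P t)^-1] in
    the traces and the frame [e t] depend on t alone, so they are constants for the s-derivative. *)

Lemma near_eq_differentiable (V W : normedModType R) (f h : V -> W) (x : V) :
  {near x, f =1 h} -> differentiable f x -> differentiable h x.
Proof.
move=> fh df; have [dfc dfx] := (diff_locallyP _ _).1 df.
have hx : h \o shift x = cst (h x) + 'd f x +o_ 0 id.
  apply/eqaddoP => _/posnumP[eps].
  move/eqaddoP/(_ _ (gt0 eps)) : dfx => dfx.
  have fh0 : \forall y \near 0, f (y + x) = h (y + x).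
    move: fh; rewrite [X in X -> _](near_shift 0).
    by apply: filterS => y /=; rewrite subr0.
  apply: filterS2 dfx fh0 => y /=; rewrite !fctE /= => + fhy.
  by rewrite fhy (nbhs_singleton fh).
have dE := diff_unique dfc hx.
by apply/diff_locallyP; rewrite dE.
Qed.

Lemma derive_sum_partial (n : nat) (f : 'rV[R]_n -> R) (x v : 'rV[R]_n) :
  differentiable f x -> 'D_v f x = \sum_j v 0 j * 'D_(delta_mx 0 j) f x.
Proof.
move=> df; rewrite deriveE // {1}(row_sum_delta v) linear_sum.
by apply: eq_bigr => j _; rewrite linearZ /= deriveE.
Qed.

Lemma differentiable_row (V : normedModType R) (n : nat) (f : V -> 'rV[R]_n) x :
  (forall j, differentiable (fun y => f y 0 j) x) -> differentiable f x.
Proof.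
move=> df.
have -> : f = \sum_j (fun y => f y 0 j *: (delta_mx 0 j : 'rV[R]_n)).
  by apply/funext => y; rewrite {1}[f y]row_sum_delta fct_sumE.
by apply: differentiable_sum => j; exact: differentiableZl.
Qed.

Lemma continuous_row (T : topologicalType) (n : nat) (f : T -> 'rV[R]_n) x :
  (forall j, {for x, continuous (fun y => f y 0 j)}) -> {for x, continuous f}.
Proof.
move=> cf A [P fP PA].
have : \forall y \near x, forall i j, P i j (f y i j).
  apply: filter_forall => i; apply: filter_forall => j.
  by have := fP i j; rewrite !ord1; exact: cf.
by rewrite nbhs_simpl /=; apply: filterS => y Py; exact: PA.
Qed.

Lemma derive_comp_row (V : normedModType R) (n : nat) (f : 'rV[R]_n -> R)
    (h : V -> 'rV[R]_n) (x v : V) :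
  differentiable h x -> differentiable f (h x) ->
  'D_v (f \o h) x = \sum_j 'D_(delta_mx 0 j) f (h x) * 'D_v (fun y => h y 0 j) x.
Proof.
move=> dh df; rewrite deriveE; last exact: differentiable_comp.
rewrite diff_comp //= -deriveE // derive_sum_partial //.
apply: eq_bigr => j _; rewrite mulrC; congr (_ * _).
by rewrite -deriveE // derive_mx ?mxE //; exact: diff_derivable.
Qed.

End Differentials.

(** * Calculus of C^k functions on a set of row vectors *)

Section Ck.
Context {R : realType}.
Implicit Types (n k : nat).

Lemma Ck_on_sub n k (E E' : set 'rV[R]_n) f :
  E' `<=` E -> Ck_on k E f -> Ck_on k E' f.
Proof.
move=> sE; elim: k f => [f cf x /sE/cf //|k IH f [df Df]]; split.
  by move=> x /sE/df.
by move=> i; exact/IH/Df.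
Qed.

(** No openness is asked of the sets [U]: differentiability and partial derivatives refer to the
    total function, so each clause is a condition at single points. It serves where the chart to be
    used varies with the point. *)
Lemma Ck_on_local n k (E : set 'rV[R]_n) f :
  (forall x, E x -> exists2 U, U x & Ck_on k U f) -> Ck_on k E f.
Proof.
elim: k f => [f H x /H[U Ux]|k IH f H]; first exact.
split; first by move=> x /H[U Ux [dU _]]; exact: dU.
by move=> i; apply: IH => x /H[U Ux [_ DU]]; exists U => //; exact: DU.
Qed.

Lemma Ck_onW n k (E : set 'rV[R]_n) f : Ck_on k.+1 E f -> Ck_on k E f.
Proof.
elim: k f => [f [df _] x Ex|k IH f [df Df]].
  exact/differentiable_continuous/df.
by split=> // i; exact/IH/Df.
Qed.

Lemma Ck_on_ext n k (E : set 'rV[R]_n) f h :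
  open E -> (forall x, E x -> f x = h x) -> Ck_on k E f -> Ck_on k E h.
Proof.
move=> oE; have nE (x : 'rV[R]_n) (f' h' : 'rV[R]_n -> R) : E x ->
    (forall x, E x -> f' x = h' x) -> {near x, f' =1 h'}.
  by move=> Ex fh; apply: filterS fh _; exact: open_nbhs_nbhs.
elim: k f h => [f h fh cf x Ex|k IH f h fh [df Df]]; last split.
- change (h @ x --> h x); rewrite -fh //; apply: cvg_trans (cf x Ex).
  exact: (near_eq_cvg (nE _ _ _ Ex fh)).
- by move=> x Ex; exact: near_eq_differentiable (nE _ _ _ Ex fh) (df x Ex).
- move=> i; apply: IH (Df i) => x Ex.
  exact: near_eq_derive (nE _ _ _ Ex fh).
Qed.

Lemma Ck_on_cst n k (E : set 'rV[R]_n) (c : R) : Ck_on k E (fun=> c).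
Proof.
elim: k c => [c x _|k IH c]; first exact: cst_continuous.
split=> [x _|i]; first exact: differentiable_cst.
suff -> : (fun x : 'rV_n => 'D_(delta_mx 0 i) (fun=> c) x) = fun=> 0 by [].
by apply/funext => x; rewrite derive_cst.
Qed.

Lemma Ck_onD n k (E : set 'rV[R]_n) f h : open E ->
  Ck_on k E f -> Ck_on k E h -> Ck_on k E (fun x => f x + h x).
Proof.
move=> oE; elim: k f h => [f h cf ch x Ex|k IH f h [df Df] [dh Dh]].
  exact: cvgD (cf x Ex) (ch x Ex).
split=> [x Ex|i]; first by apply: differentiableD; [exact: df|exact: dh].
apply: (Ck_on_ext oE) (IH _ _ (Df i) (Dh i)) => x Ex.
by rewrite deriveD //; apply: diff_derivable; [exact: df|exact: dh].
Qed.

Lemma Ck_onM n k (E : set 'rV[R]_n) f h : open E ->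
  Ck_on k E f -> Ck_on k E h -> Ck_on k E (fun x => f x * h x).
Proof.
move=> oE; elim: k f h => [f h cf ch x Ex|k IH f h cf ch].
  exact: cvgM (cf x Ex) (ch x Ex).
have [[df Df] [dh Dh]] := (cf, ch).
split=> [x Ex|i]; first by apply: differentiableM; [exact: df|exact: dh].
have := Ck_onD oE (IH _ _ (Ck_onW cf) (Dh i)) (IH _ _ (Ck_onW ch) (Df i)).
apply: (Ck_on_ext oE) => x Ex.
by rewrite deriveM //; apply: diff_derivable; [exact: df|exact: dh].
Qed.

Lemma Ck_on_sum n k (E : set 'rV[R]_n) (I : Type) (s : seq I)
    (f : I -> 'rV[R]_n -> R) : open E ->
  (forall i, Ck_on k E (f i)) -> Ck_on k E (fun x => \sum_(i <- s) f i x).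
Proof.
move=> oE cf; elim: s => [|i s IH].
  by under eq_fun do rewrite big_nil; exact: Ck_on_cst.
by under eq_fun do rewrite big_cons; exact: Ck_onD.
Qed.

Lemma Ck_on_coord n k (E : set 'rV[R]_n) j : Ck_on k E (fun x => x 0 j).
Proof.
case: k => [x _|k]; first exact: coord_continuous.
split=> [x _|i]; first exact: differentiable_coord.
suff -> : (fun x : 'rV[R]_n => 'D_(delta_mx 0 i) (fun x : 'rV[R]_n => x 0 j) x)
   = fun=> (delta_mx 0 i : 'rV[R]_n) 0 j by exact: Ck_on_cst.
apply/funext => x; have := @derive_mx R 'rV[R]_n 1 n id x (delta_mx 0 i).
rewrite derive_id => /(_ (@derivable_id _ _ _ _)) /matrixP /(_ 0 j).
by rewrite [RHS]mxE.
Qed.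

(** By the chain rule a partial derivative of the composite is a sum of products of a partial
    derivative of [f] composed with [h], handled by induction one order lower, and a partial
    derivative of a component of [h]. *)
Lemma Ck_on_comp m n k (E : set 'rV[R]_m) (U : set 'rV[R]_n) f
    (h : 'rV[R]_m -> 'rV[R]_n) : open E ->
  (forall x, E x -> U (h x)) -> (forall j, Ck_on k E (fun x => h x 0 j)) ->
  Ck_on k U f -> Ck_on k E (f \o h).
Proof.
move=> oE EU; elim: k f => [|k IH] f ch cf.
  move=> x Ex; apply: continuous_comp; last exact/cf/EU.
  by apply: continuous_row => j; exact: ch.
have [df Df] := cf.
have dh x : E x -> differentiable h x.
  by move=> Ex; apply: differentiable_row => j; have [d _] := ch j; exact: d.
split=> [x Ex|i].
  by apply: differentiable_comp; [exact: dh|exact/df/EU].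
pose D x := \sum_(j < n) 'D_(delta_mx 0 j) f (h x)
                         * 'D_(delta_mx 0 i) (fun y => h y 0 j) x.
apply: (@Ck_on_ext _ _ _ D) => // [x Ex|].
  by rewrite derive_comp_row //; [exact: dh|exact/df/EU].
apply: Ck_on_sum => // j; apply: Ck_onM => //.
  exact: (IH (fun y => 'D_(delta_mx 0 j) f y) (fun l => Ck_onW (ch l)) (Df j)).
by have [_ Dj] := ch j; exact: Dj.
Qed.

Lemma smooth_on_derive n (E : set 'rV[R]_n) f v : open E ->
  smooth_on E f -> smooth_on E (fun x => 'D_v f x).
Proof.
move=> oE cf k; have [df _] := cf 1.
apply: (@Ck_on_ext _ _ _ (fun x => \sum_j v 0 j * 'D_(delta_mx 0 j) f x)) => //.
  by move=> x Ex; rewrite derive_sum_partial //; exact: df.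
apply: Ck_on_sum => // j; apply: Ck_onM => //; first exact: Ck_on_cst.
by have [_ Df] := cf k.+1; exact: Df.
Qed.

Lemma smooth_on_differentiable n (E : set 'rV[R]_n) f x :
  smooth_on E f -> E x -> differentiable f x.
Proof. by move=> /(_ 1)[df _]; exact: df. Qed.

End Ck.

(** * Symmetry of second derivatives *)

Section Schwarz.
Context {R : realType}.

Lemma is_derive_line (V : normedModType R) (f : V -> R) (y v : V) (t : R) :
  differentiable f (y + t *: v) ->
  is_derive t 1 (fun s => f (y + s *: v)) ('D_v f (y + t *: v)).
Proof.
move=> df; have dl : is_diff t (fun s : R => y + s *: v) (fun s => s *: v).
  by apply: is_diff_eq; rewrite add0r.
have dc : differentiable (f \o (fun s : R => y + s *: v)) t.
  exact: differentiable_comp.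
apply: DeriveDef; first exact: diff_derivable.
by rewrite deriveE // diff_comp //= diff_val scale1r deriveE.
Qed.

Lemma mean_value_zero (phi dphi : R -> R) (b : R) : 0 < b ->
  (forall t, 0 <= t <= b -> is_derive t 1 phi (dphi t)) ->
  exists2 c, 0 <= c <= b & phi b - phi 0 = dphi c * b.
Proof.
move=> b0 dphiP.
have [||c cb Hc] := @MVT _ phi dphi _ _ b0.
- by move=> x xb; apply: dphiP; rewrite !ltW ?(itvP xb).
- apply: derivable_within_continuous => x xb.
  by have [] := dphiP x; rewrite ?(itvP xb).
- by exists c; rewrite ?Hc ?subr0 // !ltW ?(itvP cb).
Qed.

(** The mean value theorem is applied twice: to the increment of [f] across the parallelogram as a
    function of t, then, at the intermediate t found there, to ['D_v f] as a function of s. *)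
Lemma second_difference (V : normedModType R) (f : V -> R) (x u v : V) (b : R) :
  0 < b ->
  (forall s t, 0 <= s <= b -> 0 <= t <= b ->
    differentiable f (x + s *: u + t *: v) /\
    differentiable (fun y => 'D_v f y) (x + s *: u + t *: v)) ->
  exists s t, [/\ 0 <= s <= b, 0 <= t <= b &
    (f (x + b *: u + b *: v) - f (x + b *: v)) - (f (x + b *: u) - f x)
    = 'D_u (fun y => 'D_v f y) (x + s *: u + t *: v) * b * b].
Proof.
move=> b0 df; have b00 : 0 <= (0 : R) <= b by rewrite lexx ltW.
have bb : 0 <= b <= b by rewrite lexx ltW.
pose phi t := f (x + b *: u + t *: v) - f (x + t *: v).
pose dphi t := 'D_v f (x + b *: u + t *: v) - 'D_v f (x + t *: v).
have [|t tb phiE] := @mean_value_zero phi dphi b b0.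
  move=> t tb; apply: is_deriveB; apply: is_derive_line.
    by have [] := df b t bb tb.
  by have [+ _] := df 0 t b00 tb; rewrite scale0r addr0.
pose psi s := 'D_v f (x + t *: v + s *: u).
pose dpsi s := 'D_u (fun y => 'D_v f y) (x + t *: v + s *: u).
have [|s sb psiE] := @mean_value_zero psi dpsi b b0.
  move=> s sb; apply: (@is_derive_line _ (fun y => 'D_v f y)).
  by have [_] := df s t sb tb; rewrite addrAC.
exists s, t; split=> //; move: phiE psiE.
rewrite /phi /dphi /psi /dpsi !scale0r !addr0 => ->.
by rewrite (addrAC x (t *: v)) => ->; rewrite (addrAC x (t *: v)).
Qed.

Lemma nbhs_parallelogram (V : normedModType R) (x u v : V) (P : set V) :
  nbhs x P -> exists2 b : R, 0 < b &
    forall s t, 0 <= s <= b -> 0 <= t <= b -> P (x + s *: u + t *: v).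
Proof.
move=> /nbhs_ballP[e /= e0 eP].
have n0 : 0 < `|u| + `|v| + 1 by rewrite ltr_wpDl // addr_ge0.
(* The summand 1 keeps the denominator positive when [u] and [v] both vanish, and makes the final
   estimate strict. *)
exists (e / (`|u| + `|v| + 1)); first by rewrite divr_gt0.
move=> s t /andP[s0 sb] /andP[t0 tb]; apply: eP.
rewrite -ball_normE /= -addrA opprD addNKr normrN.
apply: le_lt_trans (ler_normD _ _) _; rewrite !normrZ !ger0_norm //.
apply: (@le_lt_trans _ _ (e / (`|u| + `|v| + 1) * (`|u| + `|v|))).
  by rewrite mulrDr lerD // ler_wpM2r.
by rewrite mulrAC -mulrA gtr_pMr // ltr_pdivrMr // mul1r ltrDl.
Qed.

(* Both mixed derivatives are limits of one symmetric second difference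
   quotient, hence of values of either derivative at intermediate points. *)
Lemma derive_symmetric (V : normedModType R) (f : V -> R) (E : set V) (x u v : V) :
  open E -> E x -> (forall y, E y -> differentiable f y) ->
  (forall y, E y -> differentiable (fun z => 'D_u f z) y) ->
  (forall y, E y -> differentiable (fun z => 'D_v f z) y) ->
  {for x, continuous (fun y => 'D_u (fun z => 'D_v f z) y)} ->
  {for x, continuous (fun y => 'D_v (fun z => 'D_u f z) y)} ->
  'D_u (fun z => 'D_v f z) x = 'D_v (fun z => 'D_u f z) x.
Proof.
move=> oE Ex df du dv cuv cvu; apply/eqP; rewrite -subr_eq0 -normr_le0.
apply/ler_addgt0Pl => e e0; rewrite addr0.
(* On a small parallelogram each mixed derivative stays within [e / 2] of its value at [x]; a common
   intermediate value then bounds the difference by [e]. *)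
have e2 : 0 < e / 2 by rewrite divr_gt0.
move/cvgrPdist_lt/(_ _ e2) : cuv => cuv; move/cvgrPdist_lt/(_ _ e2) : cvu => cvu.
have [b b0 bP] := nbhs_parallelogram u v
  (filterI (open_nbhs_nbhs (conj oE Ex)) (filterI cuv cvu)).
have [s [t [sb tb uvE]]] : exists s t, [/\ 0 <= s <= b, 0 <= t <= b &
    (f (x + b *: u + b *: v) - f (x + b *: v)) - (f (x + b *: u) - f x)
    = 'D_u (fun y => 'D_v f y) (x + s *: u + t *: v) * b * b].
  apply: second_difference => // s t sb tb.
  by have [Ey _] := bP _ _ sb tb; split; [exact: df|exact: dv].
have [s' [t' [sb' tb' vuE]]] : exists s t, [/\ 0 <= s <= b, 0 <= t <= b &
    (f (x + b *: v + b *: u) - f (x + b *: u)) - (f (x + b *: v) - f x)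
    = 'D_v (fun y => 'D_u f y) (x + s *: v + t *: u) * b * b].
  apply: second_difference => // s' t' sb' tb'; rewrite addrAC.
  by have [Ey _] := bP _ _ tb' sb'; split; [exact: df|exact: du].
(* Exchanging [u] and [v] leaves the second difference unchanged, so [uvE] and [vuE] have equal left
   sides and the factor b * b cancels. *)
have Dy : 'D_u (fun y => 'D_v f y) (x + s *: u + t *: v)
       = 'D_v (fun y => 'D_u f y) (x + t' *: u + s' *: v).
  have bn0 : b != 0 by rewrite gt_eqF.
  have E1 : x + t' *: u + s' *: v = x + s' *: v + t' *: u by exact: addrAC.
  have E2 : x + b *: v + b *: u = x + b *: u + b *: v by exact: addrAC.
  have DE (p q w z : R) : p - q - (w - z) = p - w - (q - z) by ring.
  have eqD (p q y z : R) : p = y * b * b -> q = z * b * b -> p = q -> y = z.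
    by move=> -> -> /(mulIf bn0)/(mulIf bn0).
  by rewrite E1; apply: (eqD _ _ _ _ uvE vuE); rewrite E2; exact: DE.
have [_ [/= c1 _]] := bP _ _ sb tb; have [_ [_ /= c2]] := bP _ _ tb' sb'.
rewrite [e]splitr -(subrKA ('D_u (fun y => 'D_v f y) (x + s *: u + t *: v))).
apply: le_trans (ler_normD _ _) (lerD (ltW c1) _).
by rewrite Dy distrC ltW.
Qed.

End Schwarz.

(** * Variations of the profile *)

Section SmoothFamilies.
Context {R : realType}.

Lemma smooth_on_deriveC n (E : set 'rV[R]_n) f x u v : open E -> E x ->
  smooth_on E f ->
  'D_u (fun z => 'D_v f z) x = 'D_v (fun z => 'D_u f z) x.
Proof.
move=> oE Ex sf; have sd w := smooth_on_derive w oE sf.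
apply: (derive_symmetric oE Ex) => [y|y|y||].
- exact: smooth_on_differentiable.
- exact: smooth_on_differentiable.
- exact: smooth_on_differentiable.
(* Order 0 of [smooth_on] is continuity. *)
- exact: (smooth_on_derive u oE (sd v) 0).
- exact: (smooth_on_derive v oE (sd u) 0).
Qed.

(** Functions on the line are seen as functions of a row vector of length 1, so that the calculus of
    [Ck_on] applies; this translates its partial derivative back. *)
Lemma is_derive_smooth_line (phi : R -> R) (t : R) :
  smooth_on setT (fun x : 'rV[R]_1 => phi (x 0 0)) ->
  is_derive t 1 phi
    ('D_(delta_mx 0 0) (fun x : 'rV[R]_1 => phi (x 0 0)) (const_mx t)).
Proof.
set f := fun x : 'rV[R]_1 => phi (x 0 0) => sf.
have tE s : 0 + s *: delta_mx 0 0 = const_mx s :> 'rV[R]_1.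
  by apply/rowP => i; rewrite !mxE !ord1 !eqxx mulr1 add0r.
have phiE : (fun s => f (0 + s *: delta_mx 0 0)) = phi.
  by apply/funext => s; rewrite tE /f mxE.
have := @is_derive_line _ _ f 0 (delta_mx 0 0) t.
by rewrite phiE tE; apply; exact: smooth_on_differentiable sf _.
Qed.

Lemma smooth_line_derive1 (phi : R -> R) :
  smooth_on setT (fun x : 'rV[R]_1 => phi (x 0 0)) ->
  smooth_on setT (fun x : 'rV[R]_1 => derive1 phi (x 0 0)).
Proof.
move=> sphi k; have := smooth_on_derive (delta_mx 0 0) openT sphi k.
apply: (Ck_on_ext openT) => x _.
have xE : const_mx (x 0 0) = x by apply/rowP => i; rewrite mxE ord1.
by have := @derive_val _ _ _ _ _ _ _ (is_derive_smooth_line (x 0 0) sphi);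
  rewrite derive1E xE.
Qed.

(** Written as a combination of basis vectors, so that varying one coordinate is motion along a line
    in the form required by [is_derive_line]. *)
Definition point2 (s t : R) : 'rV[R]_2 := s *: delta_mx 0 0 + t *: delta_mx 0 1.

Lemma point2_0 s t : point2 s t 0 0 = s.
Proof. by rewrite !mxE /= mulr1 mulr0 addr0. Qed.

Lemma point2_1 s t : point2 s t 0 1 = t.
Proof. by rewrite !mxE /= mulr1 mulr0 add0r. Qed.

Lemma is_derive_point2l (f : 'rV[R]_2 -> R) s t :
  differentiable f (point2 s t) ->
  is_derive s 1 (fun a => f (point2 a t)) ('D_(delta_mx 0 0) f (point2 s t)).
Proof.
rewrite /point2 addrC => /is_derive_line.
by under eq_fun do rewrite addrC.
Qed.

Lemma is_derive_point2r (f : 'rV[R]_2 -> R) s t :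
  differentiable f (point2 s t) ->
  is_derive t 1 (fun a => f (point2 s a)) ('D_(delta_mx 0 1) f (point2 s t)).
Proof. exact: is_derive_line. Qed.

(** With f the smooth extension, xi is the s-derivative of f at s = 0 on the whole of (0, L), so the
    t-derivatives of xi are mixed derivatives of f, in which the s-derivative can be moved
    outermost. *)
Lemma is_derive_profile_variation (L : R) (r xi : R -> R) (eps : R)
    (r_ : R -> R -> R) (t : R) :
  profile_variation L r xi eps r_ -> 0 < t < L ->
  [/\ is_derive (0 : R) 1 (fun s => r_ s t) (xi t),
      is_derive (0 : R) 1 (fun s => derive1 (r_ s) t) (derive1 xi t) &
      is_derive (0 : R) 1 (fun s => derive1n 2 (r_ s) t) (derive1n 2 xi t)].
Proof.
move=> [eps0 [F sF FE] _ xiE] tL.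
set f := fun z : 'rV[R]_2 => F (z 0 0) (z 0 1) in sF.
set E := [set z : 'rV[R]_2 | _] in sF.
have oE : open E.
  have -> : E = (fun z : 'rV[R]_2 => z 0 0) @^-1` [set` `]- eps, eps[].
    by apply/seteqP; split=> z /=; rewrite in_itv.
  apply: open_comp; last exact: interval_open.
  by move=> z _; exact: coord_continuous.
have Ep s u : - eps < s < eps -> E (point2 s u) by rewrite /E /= point2_0.
have e0 : - eps < 0 < eps by rewrite oppr_lt0 eps0.
have near_s : \forall s \near 0, - eps < s < eps.
  have := @near_in_itvoo R (- eps) eps 0.
  by rewrite in_itv /= => /(_ e0); apply: filterS => s; rewrite in_itv.
have near_t u : 0 < u < L -> \forall a \near u, 0 < a < L.
  move=> uL; have := @near_in_itvoo R 0 L u.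
  by rewrite in_itv /= => /(_ uL); apply: filterS => s; rewrite in_itv.
have fE s u : - eps < s < eps -> 0 < u < L -> r_ s u = f (point2 s u).
  by move=> se /andP[u0 uL]; rewrite FE ?ltW //= /f point2_0 point2_1.
pose D0 (h : 'rV[R]_2 -> R) z := 'D_(delta_mx 0 0) h z.
pose D1 (h : 'rV[R]_2 -> R) z := 'D_(delta_mx 0 1) h z.
have sD0 h : smooth_on E h -> smooth_on E (D0 h) by exact: smooth_on_derive.
have sD1 h : smooth_on E h -> smooth_on E (D1 h) by exact: smooth_on_derive.
have DC h z : smooth_on E h -> E z -> D0 (D1 h) z = D1 (D0 h) z.
  by move=> sh Ez; exact: smooth_on_deriveC sh.
(* A t-derivative at [u] sees only values near [u], hence inside (0, L), where [phi] and the
   extension agree. *)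
have derE h s u (phi : R -> R) : smooth_on E h -> - eps < s < eps -> 0 < u < L ->
    (forall a, 0 < a < L -> phi a = h (point2 s a)) ->
    derive1 phi u = D1 h (point2 s u).
  move=> sh se uL phiE.
  have dh : differentiable h (point2 s u).
    by apply: smooth_on_differentiable sh _; exact: Ep.
  rewrite derive1E /D1 -(@derive_val _ _ _ _ _ _ _ (is_derive_point2r dh)).
  by apply: near_eq_derive; apply: filterS (near_t _ uL).
have der0 h (phi : R -> R) : smooth_on E h ->
    (forall s, - eps < s < eps -> phi s = h (point2 s t)) ->
    is_derive (0 : R) 1 phi (D0 h (point2 0 t)).
  move=> sh phiE.
  have dh : differentiable h (point2 0 t).
    by apply: smooth_on_differentiable sh _; exact: Ep.
  apply: near_eq_is_derive (is_derive_point2l dh).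
  by apply: filterS near_s => s /phiE ->.
have xiF u : 0 < u < L -> xi u = D0 f (point2 0 u).
  move=> uL; have [u0 u1] := andP uL; rewrite -xiE ?ltW //.
  have df : differentiable f (point2 0 u).
    by apply: smooth_on_differentiable sF _; exact: Ep.
  rewrite derive1E /D0 -(@derive_val _ _ _ _ _ _ _ (is_derive_point2l df)).
  by apply: near_eq_derive; apply: filterS near_s => s se; rewrite fE.
have xi1 u : 0 < u < L -> derive1 xi u = D1 (D0 f) (point2 0 u).
  by move=> uL; apply: derE => //; exact: sD0.
have r1 s u : - eps < s < eps -> 0 < u < L -> derive1 (r_ s) u = D1 f (point2 s u).
  by move=> se uL; apply: derE => // a; exact: fE.
split.
- by rewrite xiF //; apply: der0 => // s se; exact: fE.
- rewrite (xi1 _ tL) -(DC f _ sF (Ep 0 t e0)).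
  by apply: der0 => [|s se]; [exact: (sD1 f)|exact: (r1 s t)].
(* Two exchanges are needed. The inner one takes place under a further t-derivative, so it must hold
   on a neighbourhood and not just at the point; [E] being open provides this. *)
- have -> : derive1n 2 xi t = D0 (D1 (D1 f)) (point2 0 t).
    rewrite derive1nS derive1n1 (derE _ 0 _ _ (sD1 _ (sD0 _ sF)) e0 tL xi1).
    rewrite (DC _ _ (sD1 _ sF) (Ep 0 t e0)).
    apply/esym/near_eq_derive.
    apply: filterS (open_nbhs_nbhs (conj oE (Ep 0 t e0))) => z Ez.
    exact: DC.
  apply: der0 => [|s se]; first exact: (sD1 _ (sD1 _ sF)).
  rewrite derive1nS derive1n1.
  exact: (derE _ s _ _ (sD1 _ sF) se tL (fun a => r1 s a se)).
Qed.

End SmoothFamilies.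

(** * Smooth maps between manifolds *)

Section SmoothMaps.
Context {R : realType}.

Lemma eq_Ck_on n k (E : set 'rV[R]_n) (f h : 'rV[R]_n -> R) :
  f =1 h -> Ck_on k E f -> Ck_on k E h.
Proof. by move=> /funext ->. Qed.

Lemma open_chart_preimage (M N : topologicalType) m (A : set (chart R M m))
    (c : chart R M m) (F : M -> N) (O : set N) :
  smooth_atlas A -> A c -> continuous F -> open O ->
  open (c_img c `&` [set x | O (F (c_inv c x))]).
Proof.
move=> sA Ac cF oO; rewrite openE => x [ix Ox]; apply: filterI.
  by apply: open_nbhs_nbhs; split=> //; exact: (atlas_img sA Ac).
have cx : {for x, continuous (F \o c_inv c)}.
  by apply: continuous_comp; [exact: (atlas_inv_cont sA Ac ix)|exact: cF].
by apply: cx; apply: open_nbhs_nbhs; split.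
Qed.

Lemma c_img_map (M : topologicalType) m (c : chart R M m) p :
  c_dom c p -> c_img c (c_map c p).
Proof. by move=> cp; exists p. Qed.

(** Near each point the coordinate expression of the composite factors through a chart of the middle
    manifold. That chart depends on the point, whence [Ck_on_local]. *)
Lemma smooth_map_comp (M N K : topologicalType) m n k (A : set (chart R M m))
    (B : set (chart R N n)) (C : set (chart R K k)) (F : M -> N) (H : N -> K) :
  smooth_atlas A -> smooth_atlas B -> smooth_atlas C ->
  smooth_map A B F -> smooth_map B C H -> smooth_map A C (H \o F).
Proof.
move=> sA sB sC [cF sF] [cH sH].
have cHF : continuous (H \o F).
  by move=> x; apply: continuous_comp; [exact: cF|exact: cH].
split=> // c e Ac Ce i l; apply: Ck_on_local => x [ix ex].
have [d Bd dx] := atlas_cover sB (F (c_inv c x)).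
pose U := (c_img c `&` [set x | c_dom e (H (F (c_inv c x)))])
  `&` (c_img c `&` [set x | c_dom d (F (c_inv c x))]).
exists U => //.
have oU : open U.
  apply: openI; first exact: open_chart_preimage sA Ac cHF (atlas_dom sC Ce).
  exact: open_chart_preimage sA Ac cF (atlas_dom sB Bd).
apply: (@Ck_on_ext _ _ _ _ ((fun y => c_map e (H (c_inv d y)) 0 i)
   \o (fun x => c_map d (F (c_inv c x))))) => // [y [_ [_ dy]]|].
  by rewrite /= (atlas_inv sB Bd).
apply: (@Ck_on_comp _ _ _ _ _
    (c_img d `&` [set y | c_dom e (H (c_inv d y))])) => // [y|j|].
- move=> [[_ ey] [_ dy]]; split; first exact: c_img_map.
  by rewrite /= (atlas_inv sB Bd).
- by apply: Ck_on_sub (sF c d Ac Bd j l) => y [].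
- exact: sH.
Qed.

Lemma smooth_map_id (M : topologicalType) m (A : set (chart R M m)) :
  smooth_atlas A -> smooth_map A A id.
Proof.
move=> sA; split=> [x //|c d Ac Ad i l].
apply: Ck_on_sub (atlas_trans sA Ac Ad i l) => x [[p cp <-]] /= dp.
by exists p => //; rewrite (atlas_inv sA Ac) in dp.
Qed.

Lemma smooth_map_cst (M N : topologicalType) m n (A : set (chart R M m))
    (B : set (chart R N n)) (q : N) : smooth_map A B (fun=> q).
Proof.
by split=> [x|c d Ac Bd i l]; [exact: cst_continuous|exact: Ck_on_cst].
Qed.

Lemma smooth_map_pair (M N K : topologicalType) m n k (A : set (chart R M m))
    (B : set (chart R N n)) (C : set (chart R K k)) (F : M -> N) (H : M -> K) :
  smooth_map A B F -> smooth_map A C H ->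
  smooth_map A (prod_atlas B C) (fun x => (F x, H x)).
Proof.
move=> [cF sF] [cH sH]; split=> [x|c _ Ac [d [e [Bd Ce ->]]] i l].
  by apply: cvg_pair; [exact: cF|exact: cH].
rewrite -(splitK i); case: (fintype.split i) => j /=.
  apply: (@eq_Ck_on _ _ _ (fun x => c_map d (F (c_inv c x)) 0 j)) => [x|].
    by rewrite row_mxEl.
  by apply: Ck_on_sub (sF c d Ac Bd j l) => x [ix [dx _]].
apply: (@eq_Ck_on _ _ _ (fun x => c_map e (H (c_inv c x)) 0 j)) => [x|].
  by rewrite row_mxEr.
by apply: Ck_on_sub (sH c e Ac Ce j l) => x [ix [_ ex]].
Qed.

Lemma prod_chart_img (M N : topologicalType) m n (c : chart R M m)
    (d : chart R N n) x :
  c_img (prod_chart c d) x <-> c_img c (lsubmx x) /\ c_img d (rsubmx x).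
Proof.
split=> [[[p q] /= [cp dq] <-]|[[p cp px] [q dq qx]]].
  by rewrite row_mxKl row_mxKr; split; exact: c_img_map.
by exists (p, q) => //=; rewrite px qx hsubmxK.
Qed.

Lemma continuous_lsubmx m n : continuous (@lsubmx R 1 m n).
Proof. by move=> x; exact/differentiable_continuous/differentiable_lsubmx. Qed.

Lemma continuous_rsubmx m n : continuous (@rsubmx R 1 m n).
Proof. by move=> x; exact/differentiable_continuous/differentiable_rsubmx. Qed.

(** Group multiplication and action are smooth for the product atlas, and composing with them
    requires it to be an atlas. Each coordinate of a product chart or of a transition comes from one
    factor, precomposed with a projection. *)
Lemma smooth_atlas_prod (M N : topologicalType) m n (A : set (chart R M m))
    (B : set (chart R N n)) :
  smooth_atlas A -> smooth_atlas B -> smooth_atlas (prod_atlas A B).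
Proof.
move=> sA sB.
have imgE (c : chart R M m) (d : chart R N n) : c_img (prod_chart c d) =
    (@lsubmx R 1 m n) @^-1` c_img c `&` (@rsubmx R 1 m n) @^-1` c_img d.
  by apply/seteqP; split=> x /prod_chart_img.
have oimg c : prod_atlas A B c -> open (c_img c).
  move=> [c1 [c2 [Ac Bc ->]]]; rewrite imgE; apply: openI; apply: open_comp.
  - by move=> ? _; exact: continuous_lsubmx.
  - exact: (atlas_img sA Ac).
  - by move=> ? _; exact: continuous_rsubmx.
  - exact: (atlas_img sB Bc).
have invc c : prod_atlas A B c ->
    forall x, c_img c x -> {for x, continuous (c_inv c)}.
  move=> [c1 [c2 [Ac Bc ->]]] x /prod_chart_img[i1 i2].
  have cl : {for x, continuous (c_inv c1 \o @lsubmx R 1 m n)}.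
    apply: continuous_comp; first exact: continuous_lsubmx.
    exact: (atlas_inv_cont sA Ac i1).
  have cr : {for x, continuous (c_inv c2 \o @rsubmx R 1 m n)}.
    apply: continuous_comp; first exact: continuous_rsubmx.
    exact: (atlas_inv_cont sB Bc i2).
  exact: cvg_pair cl cr.
have odom c : prod_atlas A B c -> open (c_dom c).
  move=> [c1 [c2 [Ac Bc ->]]]; rewrite openE => -[p q] /= [cp dq].
  exists (c_dom c1, c_dom c2) => //; split=> /=; apply: open_nbhs_nbhs; split=> //.
    exact: (atlas_dom sA Ac).
  exact: (atlas_dom sB Bc).
have invK c : prod_atlas A B c -> forall p, c_dom c p -> c_inv c (c_map c p) = p.
  move=> [c1 [c2 [Ac Bc ->]]] [p q] /= [cp dq]; rewrite row_mxKl row_mxKr.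
  by rewrite (atlas_inv sA Ac) // (atlas_inv sB Bc).
split; [|exact: odom|exact: oimg|exact: invK| |exact: invc|].
- move=> [p q]; have [c Ac cp] := atlas_cover sA p.
  by have [d Bd dq] := atlas_cover sB q; exists (prod_chart c d) => //; exists c, d.
- move=> _ [c1 [c2 [Ac Bc ->]]] [p q] /= [cp dq].
  apply: continuous_row => j; rewrite -(splitK j).
  case: (fintype.split j) => i /=.
    have -> : (fun x : M * N => row_mx (c_map c1 x.1) (c_map c2 x.2) 0
        (lshift n i)) = (fun p => c_map c1 p 0 i) \o fst.
      by apply/funext => x; rewrite row_mxEl.
    apply: (@continuous_comp _ _ _ fst (fun p => c_map c1 p 0 i)).
      exact: cvg_fst.
    apply: (@continuous_comp _ _ _ (c_map c1) (fun x : 'rV_m => x 0 i)).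
      exact: (atlas_map_cont sA Ac cp).
    exact: coord_continuous.
  have -> : (fun x : M * N => row_mx (c_map c1 x.1) (c_map c2 x.2) 0
      (rshift m i)) = (fun p => c_map c2 p 0 i) \o snd.
    by apply/funext => x; rewrite row_mxEr.
  apply: (@continuous_comp _ _ _ snd (fun p => c_map c2 p 0 i)).
    exact: cvg_snd.
  apply: (@continuous_comp _ _ _ (c_map c2) (fun x : 'rV_n => x 0 i)).
    exact: (atlas_map_cont sB Bc dq).
  exact: coord_continuous.
- move=> c d cAB dAB i l.
  (* Openness of the overlap is shown by hand, since [open_chart_preimage] presupposes the atlas
     property being proved. *)
  have oE : open (c_map c @` (c_dom c `&` c_dom d)).
    have -> : c_map c @` (c_dom c `&` c_dom d) =
        c_img c `&` [set x | c_dom d (c_inv c x)].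
      apply/seteqP; split=> [_ [p [cp dp] <-]|_ [[p cp <-]]] /=.
        by split; [exact: c_img_map|rewrite /= invK].
      by rewrite invK // => dp; exists p.
    rewrite openE => x [ix dx]; apply: filterI.
      by apply: open_nbhs_nbhs; split=> //; exact: oimg.
    by apply: (invc _ cAB x ix); apply: open_nbhs_nbhs; split=> //; exact: odom.
  move: cAB dAB oE => [c1 [c2 [Ac Bc ->]]] [d1 [d2 [Ad Bd ->]]] oE.
  rewrite -(splitK i); case: (fintype.split i) => j /=.
    apply: (@eq_Ck_on _ _ _ ((fun y => c_map d1 (c_inv c1 y) 0 j) \o lsubmx)).
      by move=> x; rewrite /= row_mxEl.
    apply: Ck_on_comp oE _ _ (atlas_trans sA Ac Ad j l) => [x|s].
      by move=> [[p q] /= [[cp _] [dp _]] <-]; rewrite row_mxKl; exists p.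
    by apply: eq_Ck_on (Ck_on_coord _ _ (lshift n s)) => x; rewrite mxE.
  apply: (@eq_Ck_on _ _ _ ((fun y => c_map d2 (c_inv c2 y) 0 j) \o rsubmx)).
    by move=> x; rewrite /= row_mxEr.
  apply: Ck_on_comp oE _ _ (atlas_trans sB Bc Bd j l) => [x|s].
    by move=> [[p q] /= [[_ cq] [_ dq]] <-]; rewrite row_mxKr; exists q.
  by apply: eq_Ck_on (Ck_on_coord _ _ (rshift m s)) => x; rewrite mxE.
Qed.

Lemma smooth_atlas_line : smooth_atlas (@line_atlas R).
Proof.
have imgT c : line_atlas c -> c_img c = [set: 'rV[R]_1].
  move=> ->; apply/seteqP; split=> // x _; exists (x 0 0) => //=.
  by apply/rowP => j; rewrite mxE ord1.
split.
- by move=> p; eexists; [reflexivity|].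
- by move=> _ ->; exact: openT.
- by move=> c /imgT ->; exact: openT.
- by move=> _ -> p _ /=; rewrite mxE.
- move=> _ -> p _ /=; apply: continuous_row => j.
  have -> : (fun t : R => (const_mx t : 'rV[R]_1) 0 j) = id.
    by apply/funext => t; rewrite mxE.
  exact: cvg_id.
- by move=> _ -> x _; exact: coord_continuous.
- move=> _ _ -> -> i l /=.
  by apply: eq_Ck_on (Ck_on_coord _ _ 0) => x; rewrite mxE.
Qed.

(** The line has a single global chart, so one condition per chart of M remains; global continuity
    is recovered from order 0 in the charts. *)
Lemma smooth_funP (M : topologicalType) m (A : set (chart R M m)) (f : M -> R) :
  smooth_atlas A ->
  smooth_fun A f <-> forall c, A c -> smooth_on (c_img c) (fun x => f (c_inv c x)).
Proof.
move=> sA; split=> [[cf sf] c Ac l|sf].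
  have := sf c _ Ac erefl 0 l; rewrite setIT.
  by apply: eq_Ck_on => x; rewrite mxE.
split=> [p|c _ Ac -> i l /=]; last first.
  by rewrite setIT; apply: eq_Ck_on (sf c Ac l) => x; rewrite mxE.
have [c Ac cp] := atlas_cover sA p.
have cfc : {for p, continuous ((fun x => f (c_inv c x)) \o c_map c)}.
  apply: continuous_comp; first exact: (atlas_map_cont sA Ac cp).
  by apply: (sf c Ac 0); exact: c_img_map.
change (f @ p --> f p); rewrite -{2}(atlas_inv sA Ac cp).
apply: cvg_trans cfc; apply: near_eq_cvg.
have := open_nbhs_nbhs (conj (atlas_dom sA Ac) cp).
by apply: filterS => q cq /=; rewrite (atlas_inv sA Ac).
Qed.

Lemma smooth_fun_comp (M N : topologicalType) m n (A : set (chart R M m))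
    (B : set (chart R N n)) (F : M -> N) (f : N -> R) :
  smooth_atlas A -> smooth_atlas B -> smooth_map A B F -> smooth_fun B f ->
  smooth_fun A (f \o F).
Proof. by move=> sA sB sF; exact: smooth_map_comp sA sB smooth_atlas_line sF. Qed.

Lemma smooth_fun_linear (M : topologicalType) m (A : set (chart R M m))
    (a : R) (f h : M -> R) : smooth_atlas A ->
  smooth_fun A f -> smooth_fun A h -> smooth_fun A (fun p => a * f p + h p).
Proof.
move=> sA /(smooth_funP _ sA) sf /(smooth_funP _ sA) sh.
apply/(smooth_funP _ sA) => c Ac l; have oE := atlas_img sA Ac.
apply: Ck_onD => //; last exact: sh.
by apply: Ck_onM => //; [exact: Ck_on_cst|exact: sf].
Qed.

Lemma smooth_fun_along_curve (M : topologicalType) m (A : set (chart R M m))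
    (gamma : R -> M) (f : M -> R) : smooth_atlas A ->
  smooth_curve A gamma -> smooth_fun A f ->
  smooth_on setT (fun x : 'rV[R]_1 => f (gamma (x 0 0))).
Proof.
move=> sA sg sf; have := smooth_fun_comp smooth_atlas_line sA sg sf.
move=> /(smooth_funP _ smooth_atlas_line)/(_ _ erefl) + l => /(_ l).
apply: Ck_on_sub => x _; exists (x 0 0) => //=.
by apply/rowP => j; rewrite mxE ord1.
Qed.

End SmoothMaps.

(** * Action fields and left-invariant fields *)

Section TangentVectors.
Context {R : realType}.

Lemma tangent_push (M N : topologicalType) m n (A : set (chart R M m))
    (B : set (chart R N n)) (F : M -> N) p v :
  smooth_atlas A -> smooth_atlas B -> smooth_map A B F ->
  tangent_at A p v -> tangent_at B (F p) (push F v).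
Proof.
move=> sA sB sF [c [u [Ac cp vE]]].
have [d Bd dFp] := atlas_cover sB (F p).
pose h x := c_map d (F (c_inv c x)).
(* The image of [u] under the Jacobian of [h], the coordinate expression of [F]; the claim is then
   the chain rule. *)
pose w := \row_j 'D_u (fun x => h x 0 j) (c_map c p).
exists d, w; split=> // f sf; rewrite /push vE; last exact: smooth_fun_comp sF sf.
have hp : h (c_map c p) = c_map d (F p) by rewrite /h (atlas_inv sA Ac).
have cpE : (c_img c `&` [set x | c_dom d (F (c_inv c x))]) (c_map c p).
  by split; [exact: c_img_map|rewrite /= (atlas_inv sA Ac)].
have dh : differentiable h (c_map c p).
  apply: differentiable_row => j.
  exact: smooth_on_differentiable (sF.2 _ _ Ac Bd j) cpE.
have df : differentiable (f \o c_inv d) (h (c_map c p)).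
  rewrite hp; apply: smooth_on_differentiable ((smooth_funP _ sB).1 sf d Bd) _.
  exact: c_img_map.
transitivity ('D_u ((f \o c_inv d) \o h) (c_map c p)).
  apply: near_eq_derive.
  have oU := open_chart_preimage sA Ac sF.1 (atlas_dom sB Bd).
  apply: filterS (open_nbhs_nbhs (conj oU cpE)) => x [_ dx].
  by rewrite /h /= (atlas_inv sB Bd).
rewrite derive_comp_row // /chart_vector derive_sum_partial; last by rewrite -hp.
by rewrite hp; apply: eq_bigr => j _; rewrite mxE mulrC.
Qed.

Lemma derive_row_mxl m n (f : 'rV[R]_(m + n) -> R) x y u :
  'D_(row_mx u 0) f (row_mx x y) = 'D_u (fun z => f (row_mx z y)) x.
Proof.
rewrite /derive; set F := (fun _ : R => _); set F' := (fun _ : R => _).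
suff -> : F = F' by []; apply/funext => a; rewrite /F /F' /=.
by rewrite scale_row_mx add_row_mx scaler0 add0r.
Qed.

Section Action.
Variables (G : groupTopologicalType) (d : nat) (AG : set (chart R G d)).
Variables (M : topologicalType) (m : nat) (AM : set (chart R M m)).
Variables (act : G -> M -> M).
Hypotheses (sG : smooth_atlas AG) (sM : smooth_atlas AM).
Hypothesis sact : smooth_action act AG AM.

Lemma smooth_orbit_map p : smooth_map AG AM (act ^~ p).
Proof.
have := smooth_map_pair (smooth_map_id sG) (smooth_map_cst AG AM p).
move=> sp.
exact: smooth_map_comp sG (smooth_atlas_prod sG sM) sM sp (action_smooth sact).
Qed.

Lemma vector_field_action (g : vectType R) (br : g -> g -> g)
    (fld : g -> G -> tvec R G) X :
  lie_algebra AG br fld -> vector_field AM (action_field act fld X).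
Proof.
move=> la; have [[tX _] _] := la_field la X.
have [c [u [Ac c1 vE]]] := tX 1%g.
split=> [p|f sf].
  rewrite -{1}(action1 sact p).
  exact: tangent_push sG sM (smooth_orbit_map p) (tX 1%g).
apply/smooth_funP => // e Ae l.
(* The function (a, p) |-> f (a p) in a product chart around the unit of G. The action field applied
   to [f] is its derivative in the direction (u, 0), restricted to the slice where the first factor
   is the unit. *)
pose Phi z := f (act (c_inv c (lsubmx z)) (c_inv e (rsubmx z))).
have sP := smooth_atlas_prod sG sM.
have Pce : prod_atlas AG AM (prod_chart c e) by exists c, e.
have sPhi : smooth_on (c_img (prod_chart c e)) Phi.
  exact: ((smooth_funP _ sP).1 (smooth_fun_comp sP sM (action_smooth sact) sf) _ Pce).
have oPE := atlas_img sP Pce.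
have oE := atlas_img sM Ae.
apply: (@Ck_on_ext _ _ _ _
   ((fun z => 'D_(row_mx u 0) Phi z) \o (fun y => row_mx (c_map c 1%g) y))) => //.
  move=> y ey; rewrite /action_field /push vE; last first.
    exact: smooth_fun_comp (smooth_orbit_map _) sf.
  apply: etrans (derive_row_mxl Phi _ _ _) _; apply: (congr1 (fun k => 'D_u k _)).
  by apply/funext => x; rewrite /Phi row_mxKl row_mxKr.
apply: Ck_on_comp (smooth_on_derive _ oPE sPhi l) => // [y ey|j].
  by apply/prod_chart_img; rewrite row_mxKl row_mxKr; split=> //; exact: c_img_map.
rewrite -(splitK j); case: (fintype.split j) => i /=.
  by apply: eq_Ck_on (Ck_on_cst _ _ (c_map c 1%g 0 i)) => y; rewrite row_mxEl.
by apply: eq_Ck_on (Ck_on_coord _ _ i) => y; rewrite row_mxEr.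
Qed.

End Action.

Section LieAlgebra.
Variables (G : groupTopologicalType) (d : nat) (AG : set (chart R G d)).
Variables (g : vectType R) (br : g -> g -> g) (fld : g -> G -> tvec R G).
Hypotheses (sG : smooth_atlas AG) (lG : lie_group AG).
Hypothesis la : lie_algebra AG br fld.

Lemma smooth_lmul a : smooth_map AG AG (fun x : G => (a * x)%g).
Proof.
have := smooth_map_pair (smooth_map_cst AG AG a) (smooth_map_id sG).
move=> sp; exact: smooth_map_comp sG (smooth_atlas_prod sG sG) sG sp (lie_mul lG).
Qed.

Lemma tangent_fld X a : tangent_at AG a (fld X a).
Proof. by have [[tX _] _] := la_field la X; exact: tX. Qed.

Lemma smooth_fld X f : smooth_fun AG f -> smooth_fun AG (fun a => fld X a f).
Proof. by have [[_ sX] _] := la_field la X; exact: sX. Qed.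

(** Left invariance transports the value at the unit to every point. This makes Q at the unit
    positive definite on the Lie algebra. *)
Lemma fld1_inj X : tangent_eq AG (fld X 1%g) (fun=> 0) -> X = 0.
Proof.
move=> X1; apply: (la_inj la) => a f sf.
have [_ lX] := la_field la X; have := lX a 1%g f sf.
rewrite mulg1 => ->; rewrite /push X1 //.
exact: smooth_fun_comp (smooth_lmul a) sf.
Qed.

(** A tangent operator equals a directional derivative on smooth functions, hence is linear there.
    Bilinearity of the bracket needs this because the commutator applies one field to the result of
    the other. *)
Lemma fld_linear_fun X (c : R) f h a : smooth_fun AG f -> smooth_fun AG h ->
  fld X a (fun b => c * f b + h b) = c * fld X a f + fld X a h.
Proof.
move=> sf sh; have [e [u [Ae ea vE]]] := tangent_fld X a.
rewrite !vE //; last exact: smooth_fun_linear.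
have df k : smooth_fun AG k -> derivable (k \o c_inv e) (c_map e a) u.
  move=> /(smooth_funP _ sG)/(_ _ Ae) sk.
  apply/diff_derivable/(smooth_on_differentiable sk).
  exact: c_img_map.
rewrite /chart_vector.
have -> : (fun b => c * f b + h b) \o c_inv e
    = c *: (f \o c_inv e) + (h \o c_inv e) by [].
by rewrite deriveD ?deriveZ //; [exact: df|exact/derivableZ/df|exact: df].
Qed.

Lemma fld_injective X Y :
  (forall a, tangent_eq AG (fld X a) (fld Y a)) -> X = Y.
Proof.
move=> XY; apply/eqP; rewrite -subr_eq0 -scaleN1r addrC; apply/eqP.
apply: (la_inj la) => a f sf.
by rewrite (la_lin la) // XY // mulN1r addNr.
Qed.

Lemma bracket_linearr X c Y Z : br X (c *: Y + Z) = c *: br X Y + br X Z.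
Proof.
apply: fld_injective => a f sf.
rewrite (la_lin la) // !(la_bracket la) // (la_lin la) //; last exact: smooth_fld.
have -> : (fun b => fld (c *: Y + Z) b f) = (fun b => c * fld Y b f + fld Z b f).
  by apply/funext => b; rewrite (la_lin la).
by rewrite fld_linear_fun; [ring|exact: smooth_fld|exact: smooth_fld].
Qed.

Lemma bracket_linearl X c Y Z : br (c *: Y + Z) X = c *: br Y X + br Z X.
Proof.
apply: fld_injective => a f sf.
rewrite (la_lin la) // !(la_bracket la) // (la_lin la) //; last exact: smooth_fld.
have -> : (fun b => fld (c *: Y + Z) b f) = (fun b => c * fld Y b f + fld Z b f).
  by apply/funext => b; rewrite (la_lin la).
by rewrite fld_linear_fun; [ring|exact: smooth_fld|exact: smooth_fld].
Qed.

Section InnerProduct.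
Variable metG : G -> tvec R G -> tvec R G -> R.
Hypothesis rG : riemannian AG metG.

Lemma fld_metricC X Y :
  metG 1%g (fld X 1%g) (fld Y 1%g) = metG 1%g (fld Y 1%g) (fld X 1%g).
Proof. by rewrite (met_sym rG) //; exact: tangent_fld. Qed.

Lemma fld_metric_linear c X Y Z :
  metG 1%g (fld (c *: X + Y) 1%g) (fld Z 1%g) =
  c * metG 1%g (fld X 1%g) (fld Z 1%g) + metG 1%g (fld Y 1%g) (fld Z 1%g).
Proof.
have tZ X' := tangent_fld X' 1%g.
rewrite -(met_lin rG) //; apply: (met_ext rG) => //; last exact: (la_lin la).
(* [fld] is linear only up to [tangent_eq], so [met_ext] asks that the pointwise combination be
   tangent; the chart vector of [fld (c *: X + Y)] represents it. *)
have [e [u [Ae ea vE]]] := tZ (c *: X + Y); exists e, u; split=> // f sf.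
by rewrite -vE // (la_lin la).
Qed.

Lemma fld_metric_pos X : X != 0 -> 0 < metG 1%g (fld X 1%g) (fld X 1%g).
Proof.
move=> /eqP X0; apply: (met_pos rG); first exact: tangent_fld.
by move=> /fld1_inj.
Qed.

End InnerProduct.
End LieAlgebra.
End TangentVectors.

(** * Curves in finite-dimensional vector spaces *)

Section VectorDerivatives.
Context {R : realType}.
Implicit Types V W : vectType R.

(** A relation joining existence and value, as [is_derive] does for scalars, so that the rules of
    differentiation compose. *)
Definition is_vderive V (f : R -> V) (t : R) (D : V) : Prop :=
  forall i, is_derive t 1 (fun s => coord (vbasis {:V}) i (f s))
                          (coord (vbasis {:V}) i D).

Lemma coord_vbasisK V (v : V) :
  v = \sum_i coord (vbasis {:V}) i v *: (vbasis {:V})`_i.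
Proof. exact: coord_vbasis (memvf v). Qed.

Lemma coord_vbasis_sum V (k : 'I_(\dim {:V}) -> R) j :
  coord (vbasis {:V}) j (\sum_i k i *: (vbasis {:V})`_i) = k j.
Proof. by rewrite coord_sum_free ?(basis_free (vbasisP _)). Qed.

Lemma is_vderiveP V (f : R -> V) t D :
  is_vderive f t D -> vderivable f t /\ vderive f t = D.
Proof.
move=> fD; split; first by move=> i; have [] := fD i.
rewrite [RHS]coord_vbasisK; apply: eq_bigr => i _; congr (_ *: _).
by rewrite derive1E; have [] := fD i.
Qed.

Lemma vderivableP V (f : R -> V) t :
  vderivable f t -> is_vderive f t (vderive f t).
Proof.
move=> df i; rewrite /vderive coord_vbasis_sum derive1E; exact: derivableP.
Qed.

(** A linear form on a finite-dimensional space is a fixed finite combination of the coordinates. In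
    particular the derivative does not depend on the basis in which it is taken. *)
Lemma is_derive_linear_form V (l : V -> R) (f : R -> V) t D :
  (forall a u v, l (a *: u + v) = a * l u + l v) -> is_vderive f t D ->
  is_derive t 1 (fun s => l (f s)) (l D).
Proof.
move=> linl fD.
have lsum v : l v = \sum_i coord (vbasis {:V}) i v * l (vbasis {:V})`_i.
  pose lM := GRing.isLinear.Build R V R^o _ l linl.
  pose lL : {linear V -> R^o} := HB.pack l lM.
  rewrite -[l]/(lL : V -> R) {1}(coord_vbasisK v) linear_sum.
  by apply: eq_bigr => i _; rewrite linearZ.
have -> : (fun s => l (f s)) =
    \sum_(i < \dim {:V})
      (l (vbasis {:V})`_i \*: (fun s => coord (vbasis {:V}) i (f s))).
  apply/funext => s; rewrite lsum fct_sumE; apply: eq_bigr => i _.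
  by rewrite mulrC.
have -> : l D = \sum_(i < \dim {:V})
    l (vbasis {:V})`_i *: coord (vbasis {:V}) i D.
  by rewrite lsum; apply: eq_bigr => i _; rewrite mulrC.
by apply: is_derive_sum => i; exact: is_deriveZ.
Qed.

Lemma is_vderive_linear V W (A : V -> W) (f : R -> V) t D :
  linear A -> is_vderive f t D -> is_vderive (fun s => A (f s)) t (A D).
Proof.
move=> linA fD i.
apply: (is_derive_linear_form (l := fun v => coord (vbasis {:W}) i (A v))) fD.
by move=> a u v; rewrite linA linearP.
Qed.

Lemma is_vderiveD V (f h : R -> V) t D E :
  is_vderive f t D -> is_vderive h t E ->
  is_vderive (fun s => f s + h s) t (D + E).
Proof.
move=> fD hE i; rewrite linearD.
under eq_fun do rewrite linearD.
exact: is_deriveD (fD i) (hE i).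
Qed.

Lemma is_vderive_sum V (I : Type) (s : seq I) (f : I -> R -> V) t D :
  (forall i, is_vderive (f i) t (D i)) ->
  is_vderive (fun u => \sum_(i <- s) f i u) t (\sum_(i <- s) D i).
Proof.
move=> fD; elim: s => [|i s IH].
  rewrite big_nil => j; under eq_fun do rewrite big_nil linear0.
  by rewrite linear0; exact: is_derive_cst.
rewrite big_cons; under eq_fun do rewrite big_cons.
exact: is_vderiveD.
Qed.

Lemma is_vderive_comp V (f : R -> V) (phi : R -> R) (t c : R) D :
  is_derive t 1 phi c -> is_vderive f (phi t) D ->
  is_vderive (fun s => f (phi s)) t (c *: D).
Proof.
move=> [dphi phicE] fD i; have [df fDE] := fD i.
pose h s := coord (vbasis {:V}) i (f s).
have dh : differentiable (h \o phi) t.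
  exact: differentiable_comp ((derivable1_diffP _ _).1 dphi)
    ((derivable1_diffP h _).1 df).
apply: DeriveDef; first exact/derivable1_diffP.
rewrite -derive1E (derive1_comp (g := h) dphi df) !derive1E phicE fDE linearZ.
exact: mulrC.
Qed.

Lemma is_vderive_scale V (phi : R -> R) (v : V) (t c : R) :
  is_derive t 1 phi c -> is_vderive (fun s => phi s *: v) t (c *: v).
Proof.
move=> phic i.
have vE a : coord (vbasis {:V}) i (a *: v) = coord (vbasis {:V}) i v *: a.
  by rewrite linearZ; exact: mulrC.
by rewrite vE; under eq_fun do rewrite vE; exact: is_deriveZ.
Qed.

Definition vsmooth V (f : R -> V) : Prop :=
  forall i, smooth_on setT
    (fun x : 'rV[R]_1 => coord (vbasis {:V}) i (f (x 0 0))).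

Lemma vsmooth_vderivable V (f : R -> V) t : vsmooth f -> vderivable f t.
Proof.
move=> sf i; pose phi s := coord (vbasis {:V}) i (f s).
by have [] := is_derive_smooth_line (phi := phi) t (sf i).
Qed.

Lemma vsmooth_vderive V (f : R -> V) : vsmooth f -> vsmooth (vderive f).
Proof.
move=> sf i; under eq_fun do rewrite /vderive coord_vbasis_sum.
exact: (smooth_line_derive1 (phi := fun s => coord (vbasis {:V}) i (f s))).
Qed.

Lemma lfun_trace_linear V a (f h : 'End(V)) :
  lfun_trace (a *: f + h) = a * lfun_trace f + lfun_trace h.
Proof.
rewrite /lfun_trace mulr_sumr -big_split; apply: eq_bigr => i _ /=.
by rewrite !lfunE /= lfunE linearP.
Qed.

Lemma derivable_sum_seq (I : Type) (s : seq I) (f : I -> R -> R) t :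
  (forall i, derivable (f i) t 1) -> derivable (fun u => \sum_(i <- s) f i u) t 1.
Proof.
move=> df; elim: s => [|i s IH].
  by under eq_fun do rewrite big_nil; exact: derivable_cst.
by under eq_fun do rewrite big_cons; exact: derivableD (df i) IH.
Qed.

Lemma derivable_prod_seq (I : Type) (s : seq I) (f : I -> R -> R) t :
  (forall i, derivable (f i) t 1) -> derivable (fun u => \prod_(i <- s) f i u) t 1.
Proof.
move=> df; elim: s => [|i s IH].
  by under eq_fun do rewrite big_nil; exact: derivable_cst.
by under eq_fun do rewrite big_cons; exact: derivableM (df i) IH.
Qed.

Lemma derivable_det n (A : R -> 'M[R]_n) t :
  (forall i j, derivable (fun s => A s i j) t 1) ->
  derivable (fun s => \det (A s)) t 1.
Proof.
move=> dA; rewrite /determinant; apply: derivable_sum_seq => s.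
by apply: derivableM; [exact: derivable_cst|exact: derivable_prod_seq].
Qed.

Lemma derivable_adjugate n (A : R -> 'M[R]_n) t i j :
  (forall i j, derivable (fun s => A s i j) t 1) ->
  derivable (fun s => (\adj (A s)) i j) t 1.
Proof.
move=> dA; under eq_fun do rewrite mxE /cofactor.
apply: derivableM; first exact: derivable_cst.
apply: derivable_det => k l.
by under eq_fun do rewrite !mxE; exact: dA.
Qed.

(** * Curves of endomorphisms through their matrices *)

Section EndMatrix.
Variable V : vectType R.
Let b := vbasis {:V}.

Definition end_mx (f : 'End(V)) : 'M[R]_(\dim {:V}) :=
  \matrix_(j, k) coord b k (f b`_j).

Definition coord_row (v : V) : 'rV[R]_(\dim {:V}) := \row_k coord b k v.

Lemma coord_row_end (f : 'End(V)) v : coord_row v *m end_mx f = coord_row (f v).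
Proof.
apply/rowP => k; rewrite !mxE {2}(coord_vbasisK v) !linear_sum.
by apply: eq_bigr => j _; rewrite !mxE !linearZ.
Qed.

Lemma coord_row_inj : injective coord_row.
Proof.
move=> u v /rowP uv; rewrite (coord_vbasisK u) (coord_vbasisK v).
by apply: eq_bigr => i _; have := uv i; rewrite !mxE => ->.
Qed.

Lemma coord_row_sum (x : 'rV[R]_(\dim {:V})) :
  coord_row (\sum_i x 0 i *: b`_i) = x.
Proof. by apply/rowP => k; rewrite mxE coord_vbasis_sum. Qed.

(** The matrix acts on coordinate rows from the right, so a row annihilated by it is a kernel vector
    of [f]. *)
Lemma lker0_det (f : 'End(V)) : (lker f == 0%VS) = (\det (end_mx f) != 0).
Proof.
apply/idP/idP => [/lker0P finj|].
  apply/negP => /det0P[x x0]; rewrite -{1}(coord_row_sum x) coord_row_end => fx0.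
  move/negP: x0; apply; apply/eqP; rewrite -(coord_row_sum x).
  have row0 : coord_row 0 = 0 by apply/rowP => k; rewrite !mxE linear0.
  rewrite -row0; congr coord_row; apply: finj; apply: coord_row_inj.
  by rewrite fx0 linear0 row0.
move=> /det0P nf; apply/lker0P => u v fuv; apply: coord_row_inj.
apply/eqP; rewrite -subr_eq0; apply/negP => /negP uv; apply: nf.
by exists (coord_row u - coord_row v); rewrite // mulmxBl !coord_row_end fuv subrr.
Qed.

(* Cramer's rule makes the coordinates of the inverse rational in those of [P]. *)
Lemma vderivable_inv_lfun (P : R -> 'End(V)) (Z : R -> V) t :
  vderivable P t -> vderivable Z t -> lker (P t) == 0%VS ->
  vderivable (fun s => ((P s)^-1)%VF (Z s)) t.
Proof.
move=> dP dZ; rewrite lker0_det => Dt k.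
have dA i j : derivable (fun s => end_mx (P s) i j) t 1.
  under eq_fun do rewrite mxE.
  have [] := is_derive_linear_form (l := fun f : 'End(V) => coord b j (f b`_i))
    _ (vderivableP dP) => // a u v.
  by rewrite !lfunE /= lfunE linearP.
have dD := derivable_det dA.
(* Invertibility is assumed at [t] only; continuity of the determinant extends it to nearby [s],
   where [(P s)^-1] is then a genuine inverse. *)
have nD : \forall s \near t, \det (end_mx (P s)) != 0.
  have cD : {for t, continuous (fun s => \det (end_mx (P s)))}.
    by apply: differentiable_continuous; exact/derivable1_diffP.
  apply: (cD (fun x => x != 0)); apply: open_nbhs_nbhs.
  by split=> //; exact: open_neq.
pose h s := (\det (end_mx (P s)))^-1
  * \sum_j coord b j (Z s) * (\adj (end_mx (P s))) j k.
apply: (@near_eq_derivable _ _ _ h).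
  apply: filterS nD => s Ds; apply: (mulfI Ds).
  rewrite /h mulrA divff // mul1r.
  have Ps : lker (P s) == 0%VS by rewrite lker0_det.
  have /(congr1 (mulmx^~ (\adj (end_mx (P s))))) :=
    coord_row_end (P s) (((P s)^-1)%VF (Z s)).
  rewrite (lker0_lfunVK Ps) -mulmxA mul_mx_adj mul_mx_scalar => /rowP/(_ k).
  rewrite !mxE => ->; apply: eq_bigr => j _.
  by rewrite [coord_row _ _ _]mxE.
apply: derivableM; first exact: derivableV.
apply: derivable_sum_seq => j; apply: derivableM; first exact: dZ.
exact: derivable_adjugate.
Qed.

(** Coordinates of [P] refer to the basis chosen for ['End(V)], which need not consist of elementary
    endomorphisms. Expanding [P s] in the constant endomorphisms [E j k], with matrix entries as
    coefficients, bridges the two. *)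
Lemma vsmooth_End (P : R -> 'End(V)) :
  (forall Y, vsmooth (fun s => P s Y)) -> vsmooth P.
Proof.
move=> sP i.
have linE j k : linear (fun v : V => coord b j v *: b`_k).
  by move=> a u v; rewrite linearP /= scalerDl scalerA.
pose E j k : 'End(V) := linfun (fun v : V => coord b j v *: b`_k).
have EE j k v : E j k v = coord b j v *: b`_k.
  pose lM := GRing.isLinear.Build R V V _ (fun v : V => coord b j v *: b`_k) (linE j k).
  pose lL : {linear V -> V} := HB.pack (fun v : V => coord b j v *: b`_k) lM.
  exact: (lfunE lL v).
have PE s : P s = \sum_(j < \dim {:V}) \sum_(k < \dim {:V}) coord b k (P s b`_j) *: E j k.
  apply/lfunP => v; rewrite {1}(coord_vbasisK v) linear_sum sum_lfunE.
  apply: eq_bigr => j _; rewrite linearZ /= {1}(coord_vbasisK (P s b`_j)).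
  rewrite scaler_sumr sum_lfunE; apply: eq_bigr => k _.
  by rewrite lfunE /= EE !scalerA mulrC.
move=> l; apply: (@eq_Ck_on _ _ _ _ (fun x =>
    \sum_(j < \dim {:V}) \sum_(k < \dim {:V})
    coord b k (P (x 0 0) b`_j) * coord (vbasis {:'End(V)}) i (E j k))).
  move=> x; rewrite {2}PE linear_sum; apply: eq_bigr => j _.
  by rewrite linear_sum; apply: eq_bigr => k _; rewrite linearZ.
apply: Ck_on_sum => [|j]; first exact: openT.
apply: Ck_on_sum => [|k]; first exact: openT.
apply: Ck_onM; [exact: openT|exact: sP|exact: Ck_on_cst].
Qed.

(* The Gram matrix of [q] is invertible, so [P] is recovered from the forms. *)
Lemma vsmooth_adjoint (q : V -> V -> R) (P : R -> 'End(V))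
    (S : V -> V -> R -> R) :
  (forall a u v w, q (a *: u + v) w = a * q u w + q v w) ->
  (forall u v, q u v = q v u) -> (forall u, u != 0 -> 0 < q u u) ->
  (forall s X Y, q X (P s Y) = S X Y s) ->
  (forall X Y, smooth_on setT (fun x : 'rV[R]_1 => S X Y (x 0 0))) ->
  vsmooth P.
Proof.
move=> qlin qC qpos qP sS; apply: vsmooth_End => Y k.
pose gram : 'M[R]_(\dim {:V}) := \matrix_(i, j) q b`_i b`_j.
have qsum u v : q u v = \sum_i coord b i u * q b`_i v.
  pose lM := GRing.isLinear.Build R V R^o _ (q^~ v) (fun a u' w => qlin a u' w v).
  pose lL : {linear V -> R^o} := HB.pack (q^~ v) lM.
  rewrite -[q u v]/(lL u : R) {1}(coord_vbasisK u) linear_sum.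
  by apply: eq_bigr => i _; rewrite linearZ.
have gramE v : coord_row v *m gram = \row_j q b`_j v.
  apply/rowP => j; rewrite !mxE qC qsum.
  by apply: eq_bigr => i _; rewrite !mxE.
have gram_unit : gram \in unitmx.
  rewrite -row_free_unit; apply/inj_row_free => x xg.
  rewrite -(coord_row_sum x); set z := \sum_i _.
  (* A row killed by the Gram matrix gives a vector [z] that [q] pairs to 0 with every basis vector,
     so [q z z] vanishes, against positivity. *)
  have z0 : z = 0.
    apply/eqP/negP => /negP/qpos; rewrite qsum.
    have := gramE z; rewrite coord_row_sum xg => /rowP g0.
    rewrite big1 ?ltxx // => i _.
    by have := g0 i; rewrite !mxE => <-; rewrite mulr0.
  by rewrite z0; apply/rowP => j; rewrite !mxE linear0.
move=> l; apply: (@eq_Ck_on _ _ _ _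
    (fun x => \sum_(j < \dim {:V}) S b`_j Y (x 0 0) * invmx gram j k)).
  move=> x; have := gramE (P (x 0 0) Y).
  move=> /(congr1 (mulmx^~ (invmx gram))); rewrite mulmxK // => /rowP/(_ k).
  rewrite !mxE => ->; apply: eq_bigr => j _.
  by rewrite mxE qP.
apply: Ck_on_sum => [|j]; first exact: openT.
apply: Ck_onM; [exact: openT|exact: sS|exact: Ck_on_cst].
Qed.

End EndMatrix.
End VectorDerivatives.

(** * The linearized tension field *)

Section TensionDerivative.
Context {R : realType} (g : vectType R) (br : g -> g -> g) (n : {vspace g}).
Variables (P : R -> 'End(subvs_of n)) (m : nat) (e : R -> 'I_m.-1 -> subvs_of n).
Hypothesis brl : forall X c Y Z, br (c *: Y + Z) X = c *: br Y X + br Z X.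
Hypothesis brr : forall X c Y Z, br X (c *: Y + Z) = c *: br X Y + br X Z.
Hypothesis sP : vsmooth P.

Lemma in_nor_linear : linear (in_nor n : R^o -> normal_sum n).
Proof.
move=> a x y; apply: (congr1 (pair (a *: x + y)) (_ : 0 = a *: 0 + 0)).
by rewrite scaler0 addr0.
Qed.

Lemma in_tan_linear : linear (@in_tan R g n).
Proof.
move=> a x y; apply: (congr1 (pair^~ (a *: x + y)) (_ : 0 = a *: 0 + 0)).
by rewrite scaler0 addr0.
Qed.

(** For fixed [X] and [Y] the expression is linear in the endomorphism [P s], since [br] is bilinear
    and the projection linear. *)
Lemma vderivable_Bplus X Y t : vderivable (fun s => Bplus br P s X Y) t.
Proof.
pose B (A : 'End(subvs_of n)) := vsproj n (2^-1 *: (br (vsval X) (vsval (A Y))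
                     - br (vsval (A X)) (vsval Y))).
have linB : linear B.
  move=> a A C; rewrite /B -linearP; congr (vsproj n _).
  rewrite !lfunE /= !lfunE /= brl brr scalerA mulrC -scalerA -scalerDr.
  by congr (_ *: _); rewrite scalerBr opprD addrACA.
by have [] := is_vderiveP (is_vderive_linear linB
  (vderivableP (vsmooth_vderivable (t := t) sP))).
Qed.

Lemma is_vderive_in_nor (phi : R -> R) (t c : R) :
  is_derive t 1 phi c -> is_vderive (fun s => in_nor n (phi s)) t (in_nor n c).
Proof.
move=> phic; have inE x : in_nor n x = x *: in_nor n 1.
  have := in_nor_linear x 1 0; rewrite addr0 [x *: 1]mulr1 => ->.
  by rewrite [in_nor n 0]/(0 : normal_sum n) addr0.
by rewrite inE; under eq_fun do rewrite inE; exact: is_vderive_scale.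
Qed.

Lemma is_vderive_tension (L eps : R) (r xi : R -> R) (r_ : R -> R -> R)
    (t lambda : R) :
  profile_variation L r xi eps r_ -> 0 < t < L -> invertible_at P (r t) ->
  is_vderive (fun s => tension br P e (r_ s) t) 0
    (jacobi_operator br P e r xi lambda t - in_nor n (lambda * xi t)).
Proof.
move=> rvar tL Pt.
have [r0 r1 r2] := is_derive_profile_variation rvar tL.
have r0t : r_ 0 t = r t by have /andP[t0 t1] := tL; rewrite (variation0 rvar) // !ltW.
pose T := lfun_trace ((P t)^-1 \o vderive P t)%VF.
(* With [P t] frozen the trace is a linear form in the remaining endomorphism, so only the curve s
   |-> [vderive P (r_ s t)] is differentiated; the chain rule yields the factor [xi t]. *)
pose l (A : 'End(subvs_of n)) := lfun_trace ((P t)^-1 \o A)%VF.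
have linl a A C : l (a *: A + C) = a * l A + l C.
  by rewrite /l comp_lfunDr -comp_lfunZr lfun_trace_linear.
have ddP : vderivable (vderive P) (r_ 0 t).
  exact/vsmooth_vderivable/vsmooth_vderive.
have dtr : is_derive (0 : R) 1 (fun s => l (vderive P (r_ s t)))
    (l (xi t *: vderive (vderive P) (r t))).
  apply: is_derive_linear_form => //; rewrite -r0t.
  exact: is_vderive_comp r0 (vderivableP ddP).
have l0 : l 0 = 0 by have := linl (-1) 0 0; rewrite scaler0 addr0 mulN1r addNr.
have lE a A : l (a *: A) = a * l A.
  by have := linl a A 0; rewrite l0 !addr0.
have dnor : is_derive (0 : R) 1 (fun s => tension_nor P (r_ s) t)
    (derive1n 2 xi t + 2^-1 * derive1 xi t * T
     - 2^-1 * (xi t * lfun_trace ((P t)^-1 \o vderive (vderive P) (r t))%VF)).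
  have d2 := is_deriveD r2 (is_deriveZ (2^-1 * T) r1).
  have := is_deriveB d2 (is_deriveZ 2^-1 dtr).
  rewrite lE; have -> : derive1n 2 xi t + (2^-1 * T) *: derive1 xi t
      - 2^-1 *: (xi t * l (vderive (vderive P) (r t)))
    = derive1n 2 xi t + 2^-1 * derive1 xi t * T
      - 2^-1 * (xi t * l (vderive (vderive P) (r t))).
    by congr (_ + _ - _); exact: mulrAC.
  congr (is_derive _ _ _ _); apply/funext => s.
  by congr (_ + _ - _); exact: mulrAC.
have dtan : is_vderive (fun s => tension_tan br P e (r_ s) t) 0
    (\sum_(j < m.-1) xi t *:
       vderive (fun rho => ((P rho)^-1)%VF (Bplus br P rho (e t j) (e t j))) (r t)).
  apply: is_vderive_sum => j; rewrite -r0t.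
  apply: (is_vderive_comp (f := fun rho =>
    ((P rho)^-1)%VF (Bplus br P rho (e t j) (e t j)))) => //.
  apply: vderivableP; apply: vderivable_inv_lfun.
  - exact: vsmooth_vderivable.
  - exact: vderivable_Bplus.
  - by rewrite r0t.
have := is_vderiveD (is_vderive_in_nor dnor) (is_vderive_linear in_tan_linear dtan).
congr is_vderive.
(* The eigenvalue term is the last summand of [jacobi_operator], and the subtraction in the
   statement cancels it. *)
rewrite /jacobi_operator addrK; congr (_ + _).
have inB x y : in_nor n (x - y) = in_nor n x - in_nor n y.
  by rewrite addrC -mulN1r (in_nor_linear (-1)) scaleN1r addrC.
have inD x y : in_nor n (x + y) = in_nor n x + in_nor n y.
  by rewrite -[x]mul1r (in_nor_linear 1) scale1r mul1r.
have E1 : 2^-1 * derive1 xi t * T = 2^-1 * T * derive1 xi t by exact: mulrAC.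
have E2 x y : 2^-1 * (x * y) = 2^-1 * y * x :> R by rewrite (mulrC x) mulrA.
by rewrite E1 E2 inB inD.
Qed.

End TensionDerivative.

Theorem proposition3p1 (R : realType)
  (M : topologicalType) (m : nat) (AM : set (chart R M m))
  (metM : M -> tvec R M -> tvec R M -> R)
  (G : groupTopologicalType) (d : nat) (AG : set (chart R G d))
  (act : G -> M -> M)
  (g : vectType R) (br : g -> g -> g) (fld : g -> G -> tvec R G)
  (L : R) (gamma : R -> M)
  (co1 : compact_cohomogeneity_one AM metM AG act br fld L gamma)
  (metG : G -> tvec R G -> tvec R G -> R)
  (Qmet : riemannian AG metG) (Qbi : biinvariant AG metG)
  (h : {vspace g}) (hH : lie_subalgebra_of AG fld (curve_fixator act gamma) h)
  (n : {vspace g}) (nh : orthogonal_complement fld n metG h)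
  (P : R -> 'End(subvs_of n))
  (PE : metric_endomorphism metM act fld metG gamma P)
  (e : R -> 'I_m.-1 -> subvs_of n)
  (eE : forall t, 0 < t < L -> orbit_frame AM metM act fld (gamma t) (e t))
  (k : R) (r : R -> R) (phi : M -> M)
  (rphi : kr_map act gamma L k r phi)
  (harm : forall t, 0 < t < L -> invertible_at P (r t) ->
     tension_nor P r t = 0 /\ tension_tan br P e r t = 0)
  (xi : R -> R) (xi0 : C0oo L xi)
  (eps : R) (r_ : R -> R -> R) (rvar : profile_variation L r xi eps r_)
  (t : R) (tL : 0 < t < L) (Pt : invertible_at P (r t)) :
  vderivable (fun s => tension br P e (r_ s) t) 0 /\
  forall lambda : R,
    vderive (fun s => tension br P e (r_ s) t) 0 + in_nor n (lambda * xi t)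
    = jacobi_operator br P e r xi lambda t.
Proof.
have sG := cm_atlas (co1_G co1); have sM := cm_atlas (co1_M co1).
have la := co1_g co1; have lG := co1_lie co1.
have vf X := vector_field_action sG sM (co1_act co1) X la.
have sP : vsmooth P.
  (* Q at the unit, restricted to n, is the inner product with respect to which [P s] represents the
     forms of the action fields along [gamma]. *)
  apply: (vsmooth_adjoint
    (q := fun X Y => metG 1%g (fld (vsval X) 1%g) (fld (vsval Y) 1%g))
    (S := fun X Y s => metM (gamma s) (action_field act fld (vsval X) (gamma s))
       (action_field act fld (vsval Y) (gamma s)))).
  - by move=> a X Y Z; rewrite linearP (fld_metric_linear la Qmet).
  - by move=> X Y; exact: (fld_metricC la Qmet).
  - move=> X X0; apply: (fld_metric_pos sG lG la Qmet).
    by apply: contra X0 => /eqP X0; apply/eqP/val_inj; rewrite linear0.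
  - by move=> s X Y; exact: PE.
  - move=> X Y; apply: (smooth_fun_along_curve
      (f := fun p => metM p (action_field act fld (vsval X) p)
                            (action_field act fld (vsval Y) p)) sM).
      by have [[]] := co1_gamma co1.
    exact: met_smooth (co1_metM co1) _ _ (vf (vsval X)) (vf (vsval Y)).
have dT lambda := is_vderiveP (is_vderive_tension e
  (bracket_linearl sG la) (bracket_linearr sG la) sP lambda rvar tL Pt).
(* Differentiability does not involve the eigenvalue, so any value such as 0 gives it; in the
   equation the eigenvalue term is added back. *)
split=> [|lambda]; first by have [] := dT 0.
by have [_ ->] := dT lambda; rewrite subrK.
Qed.
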